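(* Let $\{D_n\}_{n\in\mathbb{N}}$ be a system of Dedekind domains and $D=\bigcup_{n\in\mathbb{N}}D_n$. Then the following statements hold. (1) $D$ is a Dedekind domain if and only if $\dim(D[[X]])=2$. (2) $D$ is not a Dedekind domain if and only if $\dim(D[[X]])\ge 2^{\aleph_1}$; and in that case equality $\dim(D[[X]])=2^{\aleph_1}$ holds under the continuum hypothesis if $D$ is countable. (3) Let $M$ be a maximal ideal of $D$, and assume that $D$ is an almost Dedekind domain. Then either $\mathrm{ht}(M[[X]])=1$ or $\mathrm{ht}(M[[X]])\ge 2^{\aleph_1}$.
   Context: A system of Dedekind domains is a strictly increasing chain $D_1\subsetneq D_2\subsetneq D_3\subsetneq\cdots$ of Dedekind domains (each a subring of the next) such that: (i) each $D_j$ is not a field; (ii) for all $i<j$, each maximal ideal $P$ of $D_i$ survives in $D_j$, i.e. $PD_j\neq D_j$; (iii) for each $j\in\mathbb{N}$, each maximal ideal of $D_j$ contracts to a maximal ideal of $D_1$. Here $\mathbb{N}$ is the set of positive integers. An almost Dedekind domain is an integral domain $D$ such that $D_M$ is a DVR for every maximal ideal $M$ of $D$. $D[[X]]$ is the power series ring over $D$; for an ideal $I$ of $D$, $I[[X]]=\{\sum_{i\ge 0}a_iX^i\mid a_i\in I \text{ for all } i\ge 0\}$. The length of a chain $\mathcal{C}$ of prime ideals (a nonempty totally ordered set of primes) is $|\mathcal{C}|-1$. The Krull dimension $\dim A$ is the largest cardinal $\alpha$ (if any) such that there is a chain of prime ideals of $A$ of length $\alpha$; $\dim A\ge\alpha$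 means that there is a chain of prime ideals of $A$ of length $\ge\alpha$. The height of a prime ideal $P$ of $A$ is $\mathrm{ht}P=\dim A_P$. *)

(* Defs.v *)
From HB Require Import structures.
From mathcomp Require Import all_boot all_order all_algebra.
From mathcomp Require Import boolp classical_sets functions cardinality wochoice.

Set Implicit Arguments.
Unset Strict Implicit.
Unset Printing Implicit Defensive.

Import GRing.Theory.

Local Open Scope classical_set_scope.
Local Open Scope card_scope.
Local Open Scope ring_scope.

(* In a commutative ring, decidable invertibility and a total inverse come from
   classical logic, so that every integral domain is an idomainType. *)
Section ClassicalInverse.
Variable R : comNzRingType.

Definition classical_unit : {pred R} := fun x => `[< exists y, y * x = 1 >].

Definition classical_inv (x : R) : R :=
  if pselect (exists y, y * x = 1) is left h then sval (cid h) else x.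

Lemma classical_mulVx : {in classical_unit, left_inverse 1 classical_inv *%R}.
Proof.
move=> x /asboolP ux; rewrite /classical_inv; case: pselect => // h.
by case: cid.
Qed.

Lemma classical_unitPl (x y : R) : y * x = 1 -> classical_unit x.
Proof. by move=> yx1; apply/asboolP; exists y. Qed.

Lemma classical_invr_out : {in [predC classical_unit], classical_inv =1 id}.
Proof.
move=> x; rewrite inE => /asboolPn ux; rewrite /classical_inv.
by case: pselect.
Qed.

End ClassicalInverse.

Section Subring.
Variables (R : idomainType) (S : subringClosed R).

Record subring := Subring { subring_val : R; _ : subring_val \in S }.

HB.instance Definition _ := [isSub for subring_val].
HB.instance Definition _ := [Choice of subring by <:].
HB.instance Definition _ := [SubChoice_isSubComNzRing of subring by <:].
HB.instance Definition _ := GRing.ComNzRing_hasMulInverse.Build subring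
  (@classical_mulVx _) (@classical_unitPl _) (@classical_invr_out _).

Fact subring_integral : GRing.integral_domain_axiom subring.
Proof.
move=> x y /(congr1 val); rewrite rmorphM rmorph0 => /eqP.
by rewrite mulf_eq0 => /orP[] /eqP h; apply/orP; [left|right]; apply/eqP;
  apply: val_inj; rewrite h rmorph0.
Qed.

HB.instance Definition _ :=
  GRing.ComUnitRing_isIntegral.Build subring subring_integral.

End Subring.

Section Ideals.
Variable R : comNzRingType.
Implicit Types I P M : set R.

(* Contrary to [idealr_closed], this includes the unit ideal. *)
Definition ideal I :=
  0 \in I /\ forall a, {in I &, forall u v, a * u + v \in I}.

Definition ideal_span (G : set R) : set R := smallest ideal G.

Definition prime_ideal P := idealr_closed [in P] /\ prime_idealr_closed [in P].

Definition maximal_ideal M :=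
  idealr_closed [in M] /\
  forall I, idealr_closed [in I] -> M `<=` I -> I = M.

Definition noetherian :=
  forall I, ideal I -> exists s : seq R, I = ideal_span [set` s].

End Ideals.

Definition integrally_closed (R : idomainType) :=
  forall u : {fraction R}, integralOver (@tofrac R) u ->
    exists x : R, u = tofrac x.

(* With this definition fields are Dedekind domains. *)
Definition dedekind (R : idomainType) :=
  [/\ noetherian R, integrally_closed R &
      forall P : set R, prime_ideal P -> P <> [set 0] -> maximal_ideal P].

Definition dvr (V : idomainType) :=
  [/\ forall I : set V, ideal I -> exists a, I = ideal_span [set a],
      exists! M : set V, maximal_ideal M & ~ GRing.field_axiom V].

Section Localization.
Variables (A : idomainType) (P : prime_idealr A).

Definition localization_pred : {pred {fraction A}} := fun u =>
  `[< exists a b : A, b \notin P /\ u = tofrac a / tofrac b >].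

Fact localization_subring_closed : subring_closed localization_pred.
Proof.
have P1 : 1 \notin P by rewrite idealr1.
have nz b : b \notin P -> tofrac b != 0.
  by apply: contraNneq => /eqP; rewrite tofrac_eq0 => /eqP ->; rewrite idealr0.
have nM b d : b \notin P -> d \notin P -> b * d \notin P.
  by move=> hb hd; rewrite prime_idealrM negb_or hb.
split.
- by apply/asboolP; exists 1, 1; rewrite tofrac1 divr1.
- move=> u v /asboolP[a [b [hb ->]]] /asboolP[c [d [hd ->]]].
  apply/asboolP; exists (a * d - c * b), (b * d); split; first exact: nM.
  rewrite -mulNr addf_div ?nz // -!tofracN -!tofracM -tofracD.
  by rewrite mulNr.
- move=> u v /asboolP[a [b [hb ->]]] /asboolP[c [d [hd ->]]].
  apply/asboolP; exists (a * c), (b * d); split; first exact: nM.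
  by rewrite !tofracM mulf_div.
Qed.

HB.instance Definition _ :=
  GRing.isSubringClosed.Build {fraction A} localization_pred
    localization_subring_closed.

Definition localization := subring localization_pred.

HB.instance Definition _ := GRing.IntegralDomain.on localization.

End Localization.

Definition almost_dedekind (D : idomainType) :=
  forall M : prime_idealr D, maximal_ideal [set` M] -> dvr (localization M).

Record fps (R : Type) := Fps { fps_coef :> nat -> R }.

HB.instance Definition _ (R : Type) := [isNew for @fps_coef R].
HB.instance Definition _ (R : choiceType) := [Choice of fps R by <:].

Lemma fpsP (R : Type) (f g : fps R) : f =1 g -> f = g.
Proof. by case: f g => [f] [g] /= /funext ->. Qed.

Section FpsRing.
Variable R : comNzRingType.
Implicit Types f g h : fps R.

Definition fps_const (c : R) : fps R := Fps (fun n => if n == 0 then c else 0).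
Definition fps_opp f : fps R := Fps (fun n => - f n).
Definition fps_add f g : fps R := Fps (fun n => f n + g n).
Definition fps_mul f g : fps R :=
  Fps (fun n => \sum_(i < n.+1) f i * g (n - i)%N).

Fact fps_addA : associative fps_add.
Proof. by move=> f g h; apply: fpsP => n /=; rewrite addrA. Qed.
Fact fps_addC : commutative fps_add.
Proof. by move=> f g; apply: fpsP => n /=; rewrite addrC. Qed.
Fact fps_add0 : left_id (fps_const 0) fps_add.
Proof. by move=> f; apply: fpsP => n /=; rewrite if_same add0r. Qed.
Fact fps_addN : left_inverse (fps_const 0) fps_opp fps_add.
Proof. by move=> f; apply: fpsP => n /=; rewrite if_same addNr. Qed.

HB.instance Definition _ :=
  GRing.isZmodule.Build (fps R) fps_addA fps_addC fps_add0 fps_addN.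

Let trunc m f : {poly R} := \poly_(i < m) f i.

Let trunc_mul m f g n : (n < m)%N -> (trunc m f * trunc m g)`_n = fps_mul f g n.
Proof.
move=> nm; rewrite coefM; apply: eq_bigr => i _.
by rewrite !coef_poly (leq_ltn_trans _ nm) ?leq_ord // (leq_ltn_trans _ nm)
  ?leq_subr.
Qed.

Fact fps_mulC : commutative fps_mul.
Proof.
move=> f g; apply: fpsP => n.
by rewrite -!(trunc_mul _ _ (ltnSn n)) mulrC.
Qed.

Fact fps_mulA : associative fps_mul.
Proof.
move=> f g h; apply: fpsP => n.
have eqL : fps_mul f (fps_mul g h) n =
    (trunc n.+1 f * (trunc n.+1 g * trunc n.+1 h))`_n.
  rewrite coefM; apply: eq_bigr => i _.
  by rewrite coef_poly ltn_ord trunc_mul // ltnS leq_subr.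
have eqR : fps_mul (fps_mul f g) h n =
    (trunc n.+1 f * trunc n.+1 g * trunc n.+1 h)`_n.
  rewrite coefM; apply: eq_bigr => i _.
  by rewrite trunc_mul ?ltn_ord // coef_poly ltnS leq_subr.
by rewrite eqL eqR mulrA.
Qed.

Fact fps_mul1 : left_id (fps_const 1) fps_mul.
Proof.
move=> f; apply: fpsP => n /=.
by rewrite big_ord_recl /= mul1r subn0 big1 ?addr0 // => i _; rewrite mul0r.
Qed.

Fact fps_mulDl : left_distributive fps_mul fps_add.
Proof.
move=> f g h; apply: fpsP => n /=; rewrite -big_split /=.
by apply: eq_bigr => i _; rewrite mulrDl.
Qed.

Fact fps_1neq0 : fps_const 1 != 0 :> fps R.
Proof.
by apply/eqP => /(congr1 (fun f : fps R => f 0)) /= /eqP; rewrite oner_eq0.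
Qed.

HB.instance Definition _ := GRing.Zmodule_isComNzRing.Build (fps R)
  fps_mulA fps_mulC fps_mul1 fps_mulDl fps_1neq0.
HB.instance Definition _ := GRing.ComNzRing_hasMulInverse.Build (fps R)
  (@classical_mulVx _) (@classical_unitPl _) (@classical_invr_out _).

End FpsRing.

Section FpsDomain.
Variable D : idomainType.

(* If f and g are not in M[[X]] then neither is f * g: consider the first
   coefficients of f and g outside M. *)
Lemma fps_mul_mem (M : zmodClosed D) :
    (forall a u : D, u \in M -> a * u \in M) ->
    (forall u v : D, u * v \in M -> (u \in M) || (v \in M)) ->
  forall f g : fps D, (forall i, (f * g) i \in M) ->
    (forall i, f i \in M) \/ (forall i, g i \in M).
Proof.
move=> MM Mp f g fg.
have [fM|/existsNP exf] := pselect (forall i, f i \in M); first by left.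
have [gM|/existsNP exg] := pselect (forall i, g i \in M); first by right.
have exf' : exists i, f i \notin M by case: exf => i /negP; exists i.
have exg' : exists i, g i \notin M by case: exg => i /negP; exists i.
exfalso; case: (ex_minnP exf') => m fm minf; case: (ex_minnP exg') => n gn ming.
have mlt : (m < (m + n).+1)%N by rewrite ltnS leq_addr.
have := fg (m + n); rewrite /= (bigD1 (Ordinal mlt)) //= addKn.
rewrite rpredDr; last first.
  apply: rpred_sum => i; rewrite -val_eqE /= neq_ltn => /orP[im|mi].
    have fi : f i \in M.
      by apply: contraLR im => /minf; rewrite -leqNgt.
    by rewrite mulrC MM.
  apply: MM; apply: contraLR mi => /ming.
  rewrite -leqNgt leq_subRL; last by rewrite -ltnS.
  by rewrite leq_add2r.
by move=> /Mp; rewrite (negbTE fm) (negbTE gn).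
Qed.

Fact fps_integral : GRing.integral_domain_axiom (fps D).
Proof.
move=> f g fg0; have z (h : fps D) : (forall i, h i = 0) -> h == 0.
  by move=> h0; apply/eqP/fpsP => i; rewrite h0 /= if_same.
pose Z : {pred D} := [pred x | x == 0].
have Zc : zmod_closed Z.
  by split=> [|x y]; rewrite !inE // => /eqP -> /eqP ->; rewrite subr0.
pose ZC := GRing.isZmodClosed.Build D Z Zc.
pose Zp : zmodClosed D := HB.pack Z ZC.
have [| |i|h|h] := @fps_mul_mem Zp _ _ f g.
- by move=> a u; rewrite !inE => /eqP ->; rewrite mulr0.
- by move=> u v; rewrite !inE mulf_eq0.
- by rewrite fg0 inE /= if_same.
- by apply/orP; left; apply: z => i; apply/eqP; have := h i.
- by apply/orP; right; apply: z => i; apply/eqP; have := h i.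
Qed.

HB.instance Definition _ :=
  GRing.ComUnitRing_isIntegral.Build (fps D) fps_integral.

(* The prime ideal M[[X]]. *)
Definition fps_ideal (M : prime_idealr D) : {pred fps D} :=
  fun f => `[< forall i, f i \in M >].

Fact fps_ideal_idealr_closed (M : prime_idealr D) : idealr_closed (fps_ideal M).
Proof.
split.
- by apply/asboolP => i /=; rewrite if_same idealr0.
- by apply/asboolPn => /(_ 0); rewrite /= idealr1.
- move=> h f g /asboolP fM /asboolP gM; apply/asboolP => i /=.
  apply: rpredD; last exact: gM.
  by apply: rpred_sum => j _; apply: idealMr.
Qed.

Fact fps_ideal_prime (M : prime_idealr D) : prime_idealr_closed (fps_ideal M).
Proof.
move=> f g /asboolP fgM; apply/orP.
have [|u v|h|h] := fps_mul_mem (M := M) _ _ fgM.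
- by move=> a u; apply: idealMr.
- by rewrite prime_idealrM.
- by left; apply/asboolP.
- by right; apply/asboolP.
Qed.

HB.instance Definition _ (M : prime_idealr D) :=
  isIdealr.Build (fps D) (fps_ideal M) (fps_ideal_idealr_closed M).
HB.instance Definition _ (M : prime_idealr D) :=
  isPrimeIdealrClosed.Build (fps D) (fps_ideal M) (@fps_ideal_prime M).

End FpsDomain.

(* A cardinal is represented by any set of that cardinality. *)
Section KrullDimension.
Variable A : comNzRingType.
Implicit Types C : set (set A).

Definition prime_chain C :=
  [/\ C !=set0, C `<=` @prime_ideal A & total_on C subset].

(* The cardinal |C| - 1, as C with one (chosen) element removed. *)
Definition chain_length C : set (set A) := C `\ xget set0 C.

Definition krull_dim_ge (T : Type) (alpha : set T) :=
  exists C, prime_chain C /\ alpha #<= chain_length C.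

Definition krull_dim_eq (T : Type) (alpha : set T) :=
  (exists C, prime_chain C /\ chain_length C #= alpha) /\
  (forall C, prime_chain C -> chain_length C #<= alpha).

End KrullDimension.

Definition height_ge (A : idomainType) (P : prime_idealr A) T (alpha : set T) :=
  krull_dim_ge (localization P) alpha.

Definition height_eq (A : idomainType) (P : prime_idealr A) T (alpha : set T) :=
  krull_dim_eq (localization P) alpha.

(* The least uncountable cardinal. *)
Definition is_aleph1 (T : Type) :=
  ~ countable [set: T] /\
  forall A : set T, ~ countable A -> A #= [set: T].

Lemma aleph1_exists : exists T : Type, is_aleph1 T.
Proof.
have [R Rwo] := well_ordering_principle (set nat).
have wo : wo_chain R predT by move=> A _ /Rwo.
have Ranti x y : R x y -> R y x -> x = y.
  by move=> xy yx; apply: (wo_chain_antisymmetric wo) => //; rewrite xy yx.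
pose ini (x : set nat) := [set y | R y x].
pose U := {x : set nat | `[< countable (ini x) >]}.
have unc : ~ countable [set: U].
  move=> /countable_injP[f finj].
  have [allc|/existsNP[x0 nx0]] := pselect (forall x, countable (ini x)).
    pose g x := f (exist _ x (asboolT (allc x)) : U).
    have ginj : injective g by move=> x y /finj; rewrite !inE => /(_ I I) [].
    pose d := [set n | exists x : set nat, g x = n /\ ~ x n].
    have [dd|nd] := pselect (d (g d)).
      by have [x [/ginj xd nx]] := dd; apply: nx; rewrite xd.
    by apply: (nd); exists d.
  have [|z [[zA zmin] _]] := Rwo [pred x | ~~ `[< countable (ini x) >]].
    by exists x0; rewrite inE; apply/asboolPn.
  move: zA; rewrite inE => /asboolPn; apply; apply/countable_injP.
  have inU y : R y z -> y <> z -> `[< countable (ini y) >].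
    move=> yz ne; apply: contrapT => /negP nc; apply: ne; apply: Ranti => //.
    by apply: zmin; rewrite inE.
  pose g y := if pselect (`[< countable (ini y) >]) is left h
    then (f (exist _ y h : U)).+1 else 0.
  exists g => x y; rewrite !inE /ini /g /= => xz yz.
  case: pselect => [hx|hx]; case: pselect => [hy|hy] //.
    by case=> /finj; rewrite !inE => /(_ I I) [].
  have xe : x = z by apply: contrapT => /(inU _ xz).
  by have -> : y = z by apply: contrapT => /(inU _ yz).
exists U; split=> // A Aunc.
pose lt (x y : U) := R (sval x) (sval y) /\ x <> y.
have tot x y : x <> y -> lt x y \/ lt y x.
  move=> ne; have /orP[xy|yx] := wo_chainW wo (x := sval x) (y := sval y) isT isT.
    by left.
  by right; split=> // /esym.
have ltwf : well_founded lt.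
  move=> x; apply: contrapT => nx.
  have [|z [[/asboolP[u [uz nu]] zmin] _]] :=
    Rwo (fun y => `[< exists u : U, sval u = y /\ ~ Acc lt u >]).
    by exists (sval x); apply/asboolP; exists x.
  apply: nu; constructor=> v [vu vneu]; apply: contrapT => nv.
  apply/vneu/val_inj/Ranti => //=.
  by rewrite uz; apply: zmin; apply/asboolP; exists v.
have ltc x : countable [set y | lt y x].
  have /countable_injP[f finj] : countable (ini (sval x)).
    by case: x => x /= /asboolP.
  apply/countable_injP; exists (f \o sval) => u v.
  by rewrite !inE => -[ux _] [vx _] /finj; rewrite !inE => /(_ ux vx)/val_inj.
have fresh x (f : forall y, lt y x -> U) :
    exists a, A a /\ forall y (yx : lt y x), f y yx <> a.
  apply: contrapT => /forallNP nf; apply: Aunc.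
  pose g y := if pselect (lt y x) is left h then f y h else y.
  apply: (@sub_countable _ _ _ (g @` [set y | lt y x])).
    apply: subset_card_le => a Aa.
    have /not_andP[//|/existsNP[y /existsNP[yx /contrapT fa]]] := nf a.
    exists y => //; rewrite /g; case: pselect => // h.
    by rewrite -fa; congr f; apply: Prop_irrelevance.
  exact: sub_countable (card_image_le _ _) (ltc x).
pose F x f := sval (cid (fresh x f)).
pose f := Fix ltwf (fun=> U) F.
have fE x : f x = F x (fun y _ => f y).
  apply: (Fix_eq ltwf (fun=> U) F) => {}x g h gh; congr F.
  by apply/functional_extensionality_dep => y; apply/funext.
have fP x : A (f x) /\ forall y, lt y x -> f y <> f x.
  by rewrite [f x]fE /F; case: cid.
have finj : injective f.
  move=> x y fxy; apply: contrapT => /tot[] /(proj2 (fP _)); first exact.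
  by rewrite fxy.
apply: Cantor_Bernstein; first exact: subset_card_le.
apply: (@card_le_trans _ _ _ (f @` setT)).
  by rewrite (card_le_eqr (inj_card_eq (fun x y _ _ => @finj x y))).
by apply: subset_card_le => _ [x _ <-]; case: (fP x).
Qed.

Definition aleph1 : Type := sval (cid aleph1_exists).

Lemma aleph1P : is_aleph1 aleph1.
Proof. exact: svalP (cid aleph1_exists). Qed.

Definition continuum_hypothesis := [set: set nat] #= [set: aleph1].

(* For a subset P of the subring S, P `&` T viewed as a subset of the subring T;
   it is the copy of P in T when S is contained in T, and the contraction of P
   to T when T is contained in S. *)
Definition subring_meet (R : idomainType) (S T : subringClosed R)
  (P : set (subring S)) : set (subring T) := val @^-1` (val @` P).

Arguments subring_meet {R S} T P.

Section System.
Variables (R : idomainType) (D : nat -> subringClosed R).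

(* A system D 0, D 1, D 2, ... of subrings of a common domain R; the index of
   the first ring is 0 instead of 1. *)
Record dedekind_system : Prop := {
  system_subset : forall n, {subset D n <= D n.+1} ;
  system_proper : forall n, exists2 x, x \in D n.+1 & x \notin D n ;
  system_dedekind : forall n, dedekind (subring (D n)) ;
  system_nonfield : forall n, ~ GRing.field_axiom (subring (D n)) ;
  system_survive : forall i j (P : set (subring (D i))), (i < j)%N ->
    maximal_ideal P -> ideal_span (subring_meet (D j) P) <> setT ;
  system_contract : forall j (P : set (subring (D j))),
    maximal_ideal P -> maximal_ideal (subring_meet (D 0) P)
}.

End System.

(* Main.v *)
Require Import Defs.
From HB Require Import structures.
From mathcomp Require Import all_boot all_order all_algebra.
From mathcomp Require Import boolp classical_sets functions cardinality wochoice filter.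
From mathcomp Require Import zify ring.

Set Implicit Arguments.
Unset Strict Implicit.
Unset Printing Implicit Defensive.

Import GRing.Theory.

Local Open Scope classical_set_scope.
Local Open Scope card_scope.
Local Open Scope ring_scope.

(* Let M be a maximal ideal of D and M_n its trace on D_n.
   - If every M_n is contained in a maximal ideal other than M, there are maximal
     ideals P_n <> M containing larger and larger traces of M, and each P_n gives
     a valuation f |-> ord_X (f mod P_n).
   - If D_M is not discrete, there are d_n in M whose values v (d_n) decrease
     arbitrarily fast, and each gives the valuation
     f |-> min_i (v (f_i) / v (d_n) + i).
   In both cases the sequence of values of a suitable f follows any prescribed
   nondecreasing unbounded growth rate g with g n <= n. Hence, along a nonprincipal
   ultrafilter, the cuts of growth rates closed under addition give prime ideals
   inside M[[X]]. A binary tree of height omega_1 of nested gaps between growth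
   rates, whose limit stages are filled by diagonalization, yields 2^aleph_1 such
   cuts.
   - Otherwise M is finitely generated and locally principal, and M[[X]] has height
     1. If this holds for all M, then D is Dedekind by Cohen's theorem.
   If D is Dedekind, let P < Q be nonzero primes of D[[X]] with X not in Q, and f in
   Q but not in P. The constant terms of the Q-saturations of (f^n) + P stabilize,
   because D / (c) is artinian for c <> 0; by X-adic completeness so do these
   ideals, which is absurd. This bounds the dimension by 2. *)

(** * Cardinals *)

(** A prime cut must be stable under addition of values, so two growth rates count as different only
    when every multiple of one stays below the other; hence gaps are measured by [negligible].
    Height omega_1 is what diagonalization reaches: a node has only countably many predecessors, and
    countably many nested gaps always leave room for another one. The bound g n <= n comes from the
    second construction, where d_(n-1) is only known to exceed the n-th power of d_n in value. The
    rings D_n serve to place finitely many elements of D inside one Dedekind domain. So divisibility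
    at M is total and archimedean, and each trace M_n is finitely generated. If some M_n lies in no
    maximal ideal but M, its generators generate the unit ideal locally at every other maximal
    ideal, and one local generator at M completes them. *)

Section Cardinals.

Lemma card_leTP T U (B : set U) : [set: T] #<= B ->
  exists f : T -> U, injective f /\ forall x, B (f x).
Proof.
have [[x0 _]|T0 _] := pselect ([set: T] !=set0).
  move=> TB; have [[u0 _]|U0] := pselect (B !=set0); last first.
    move: TB; have -> : B = set0 by apply: contrapT => /eqP/set0P.
    by move=> /card_le0P T0; have : [set: T] x0 by []; rewrite T0.
  pose m := isPointed.Build U u0.
  pose pU : pointedType := HB.pack U (gen_eqMixin U) (gen_choiceMixin U) m.
  have /(@pcard_leP T pU)/injfunPex[f fB finj] := TB.
  exists f; split=> [x y|x]; last exact: fB.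
  by apply: finj; rewrite inE.
have nT (x : T) : False by apply: T0; exists x.
by exists (fun x => False_rect _ (nT x)); split=> [x|x]; case: (nT x).
Qed.

Lemma inj_card_leT T U (B : set U) (f : T -> U) :
  injective f -> (forall x, B (f x)) -> [set: T] #<= B.
Proof.
move=> finj fB; apply: (@card_le_trans _ _ _ (f @` setT)).
  by rewrite (card_le_eqr (inj_card_eq (fun x y _ _ => @finj x y))).
by apply: subset_card_le => _ [x _ <-].
Qed.

(* [set T] splits into two disjoint copies of itself (sets with or without [t0],
   all other points being shifted along [s]), one of which avoids [p]. *)
Lemma card_le_setD1 T U (B : set U) (p : U) (f : set T -> U) (s : T -> T) t0 :
  injective s -> (forall t, s t <> t0) ->
  injective f -> (forall x, B (f x)) -> [set: set T] #<= B `\ p.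
Proof.
move=> sinj st0 finj fB.
pose g (b : bool) (A : set T) := [set t | (exists2 a, A a & s a = t) \/ (b /\ t = t0)].
have ginj b : injective (g b).
  move=> A A' /seteqP gE; apply/seteqP; split=> t At.
    have [] := gE.1 (s t); first by left; exists t.
      by move=> [a Aa /sinj <-].
    by move=> [_ /st0].
  have [] := gE.2 (s t); first by left; exists t.
    by move=> [a Aa /sinj <-].
  by move=> [_ /st0].
have gne A A' : g true A <> g false A'.
  move=> /seteqP gE; have [] := gE.1 t0; first by right.
    by case=> a _ /st0.
  by case.
have [[A0 A0p]|np] := pselect (exists A, f (g true A) = p).
  apply: (@inj_card_leT _ _ _ (f \o g false)) => [A A' /finj/ginj //|A].
  by split=> //= fp; apply: (gne A0 A); apply: finj; rewrite A0p fp.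
apply: (@inj_card_leT _ _ _ (f \o g true)) => [A A' /finj/ginj //|A].
by split=> //= fp; apply: np; exists A.
Qed.

(** Well-order [aleph1]. If some initial segment is uncountable, the segment below the least such
    point is uncountable and has only countable initial segments itself; [aleph1] injects into it,
    and the order is pulled back. *)
Lemma aleph1_order : exists lt : aleph1 -> aleph1 -> Prop,
  [/\ well_founded lt, (forall x y z, lt x y -> lt y z -> lt x z),
      (forall x y, x <> y -> lt x y \/ lt y x) &
      forall x, countable [set y | lt y x]].
Proof.
have [unc alP] := aleph1P; pose T := {classic aleph1}.
have [R Rwo] := well_ordering_principle T.
have wo : wo_chain R predT by move=> A _ /Rwo.
have Ranti x y : R x y -> R y x -> x = y.
  by move=> xy yx; apply: (wo_chain_antisymmetric wo) => //; rewrite xy yx.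
have Rtot x y : R x y || R y x by exact: (wo_chainW wo).
have Rmin (A : set T) : A !=set0 -> exists2 z, A z & forall y, A y -> R z y.
  move=> [x Ax]; have [|z [[zA zmin] _]] := Rwo (fun y => `[< A y >]).
    by exists x; apply/asboolP.
  by exists z => [|y Ay]; [exact/asboolP|apply/zmin/asboolP].
pose lt x y := R x y /\ x <> y.
have lt_tot x y : x <> y -> lt x y \/ lt y x.
  move=> xy; have /orP[h|h] := Rtot x y; [left|right]; split=> //.
  exact: nesym.
have lt_wf : well_founded lt.
  move=> x; apply: contrapT => nx.
  have [z nz zmin] := Rmin [set x | ~ Acc lt x] (ex_intro _ x nx).
  apply: nz; constructor=> y [yz ne]; apply: contrapT => /zmin zy.
  by apply: ne; apply: Ranti.
have lt_trans x y z : lt x y -> lt y z -> lt x z.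
  move=> [xy nxy] [yz nyz].
  have [w + wmin] := Rmin [set x; y; z] (ex_intro _ x (or_introl (or_introl erefl))).
  have wx : R w x by apply: wmin; left; left.
  have wy : R w y by apply: wmin; left; right.
  have wz : R w z by apply: wmin; right.
  move=> [[we|we]|we]; rewrite we in wx wy wz => {w we wmin}.
  - split=> // xz; rewrite -xz in yz; exact: (nxy (Ranti _ _ xy yz)).
  - by case: nxy; apply: Ranti.
  - by case: nyz; apply: Ranti.
suff [A [Aunc Ac]] : exists A : set T, ~ countable A /\
    forall x, A x -> countable [set y | lt y x].
  have /card_eqPle[_ /card_leTP[f [finj fA]]] := alP _ Aunc.
  exists (fun x y => lt (f x) (f y)); split.
  - suff H u : Acc lt u -> forall x, f x = u -> Acc (fun x y => lt (f x) (f y)) x.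
      by move=> x; apply: (H (f x)).
    by elim=> v _ IH x fxv; constructor => y yx; apply: (IH (f y)) => //; rewrite -fxv.
  - by move=> x y z; apply: lt_trans.
  - by move=> x y xy; apply: lt_tot => /finj.
  - move=> x; have /countable_injP[h hinj] := Ac _ (fA x).
    apply/countable_injP; exists (h \o f) => y z; rewrite !inE /= => yx zx e.
    by apply: finj; apply: hinj => //; rewrite inE.
have [allc|/existsNP[x0 nx0]] := pselect (forall x, countable [set y | lt y x]).
  by exists setT; split.
have [z nz zmin] := Rmin [set x | ~ countable [set y | lt y x]] (ex_intro _ x0 nx0).
exists [set y | lt y z]; split=> // x [xz ne]; apply: contrapT => /zmin zx.
by apply: ne; apply: Ranti.
Qed.

(** Hilbert's hotel along an injected sequence [u]: [u n] moves to [u n.+1], everything else stays,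
    and [u 0] is vacated. *)
Lemma aleph1_shift : exists (s : aleph1 -> aleph1) t0,
  injective s /\ forall t, s t <> t0.
Proof.
have [unc _] := aleph1P.
have /infiniteP/card_leTP[u [uinj _]] : infinite_set [set: aleph1].
  by move=> /finite_set_countable.
pose inu t (h : exists n, u n = t) := sval (cid h).
pose s t := if pselect (exists n, u n = t) is left h then u (inu t h).+1 else t.
have uE t h : u (inu t h) = t by rewrite /inu; case: cid.
exists s, (u 0); split=> [t t'|t]; rewrite /s.
  case: pselect => [h|h]; case: pselect => [h'|h'].
  - by move=> /uinj[e]; rewrite -(uE t h) -(uE t' h') e.
  - by move=> e; case: h'; exists (inu t h).+1.
  - by move=> e; case: h; exists (inu t' h').+1.
  - by [].
by case: pselect => [h /uinj //|h e]; apply: h; exists 0.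
Qed.

End Cardinals.

(** * Growth rates *)

Definition dominated (g h : nat -> nat) := \forall n \near \oo, (g n <= h n)%N.

(** Little-o in integral form: ranging over all multiples [k] makes the cuts defined by it closed
    under addition. *)
Definition negligible (g h : nat -> nat) :=
  forall k, \forall n \near \oo, (k * g n <= h n)%N.

Definition unbounded (g : nat -> nat) := forall k, \forall n \near \oo, (k <= g n)%N.

Notation nondecreasing g := {homo (g : nat -> nat) : m n / (m <= n)%N}.

Section Growth.
Local Open Scope nat_scope.
Implicit Types (c g h : nat -> nat).

Lemma dominated_trans g h c : dominated g h -> dominated h c -> dominated g c.
Proof. by apply: filterS2 => n; apply: leq_trans. Qed.

Lemma dominated_negligible g h c :
  dominated g h -> negligible h c -> negligible g c.
Proof.
move=> gh hc k; apply: filterS2 gh (hc k) => n gh; apply: leq_trans.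
by rewrite leq_mul2l gh orbT.
Qed.

Lemma negligible_dominated g h c :
  negligible g h -> dominated h c -> negligible g c.
Proof. by move=> gh hc k; apply: filterS2 (gh k) hc => n; apply: leq_trans. Qed.

Lemma negligibleW g h : negligible g h -> dominated g h.
Proof. by move=> /(_ 1); apply: filterS => n; rewrite mul1n. Qed.

Lemma unbounded_dominated g h : unbounded g -> dominated g h -> unbounded h.
Proof. by move=> gu gh k; apply: filterS2 (gu k) gh => n; apply: leq_trans. Qed.

Lemma unbounded_id : unbounded id.
Proof. by move=> k; exists k. Qed.

Lemma near_forall_ltn (P : nat -> nat -> Prop) K :
  (forall i, \forall n \near \oo, P i n) ->
  \forall n \near \oo, forall i, i < K -> P i n.
Proof.
move=> HP; elim: K => [|K IH]; first by apply: filterE.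
apply: filterS2 (HP K) IH => n PK IH i; rewrite ltnS leq_eqVlt => /orP[/eqP -> //|].
exact: IH.
Qed.

(** A diagonal argument: [K n] measures how many of the bounds are separated by a factor [K n * K n]
    from [n] on, and [c n] is the maximum of the lower bounds counted. The two factors [K] make room
    for two gaps, from [c] to [K * c] and from there to [K * K * c]. *)
Lemma gap_fill (a b : nat -> nat -> nat) :
    (forall i, nondecreasing (a i)) ->
    (forall i j, negligible (a i) (b j)) ->
  exists c K : nat -> nat, [/\ nondecreasing c, nondecreasing K, unbounded K,
    forall i, dominated (a i) c &
    forall j, dominated (fun n => K n * K n * c n) (b j)].
Proof.
move=> amono ab.
(* Asking for all [m >= n] makes [P K] persist, so that the maximal [K] is nondecreasing in [n]; the
   bound [K <= n] below ensures that a maximum exists. *)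
pose P K n := forall m, n <= m -> forall i j, i <= K -> j <= K -> K * K * a i m <= b j m.
have PS K n n' : n <= n' -> P K n -> P K n'.
  by move=> nn' PK m n'm; apply: PK; apply: leq_trans n'm.
have exK n : exists K, [/\ K <= n, P K n & forall K', K' <= n -> P K' n -> K' <= K].
  pose p K := (K <= n) && `[< P K n >].
  have p0 : exists K, p K.
    by exists 0; apply/andP; split => //; apply/asboolP => m _ i j; rewrite !mul0n.
  have pn K : p K -> K <= n by case/andP.
  have [K /andP[Kn /asboolP PK] Kmax] := ex_maxnP p0 pn.
  by exists K; split=> // K' K'n PK'; apply: Kmax; apply/andP; split=> //; apply/asboolP.
have [K KP] := choice exK.
have Kmono : nondecreasing K.
  move=> m n mn; have [_ _ Kmax] := KP n; have [Km PK _] := KP m.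
  by apply: Kmax; [apply: leq_trans mn|apply: PS PK].
have Kunb : unbounded K.
  move=> k.
  have : \forall n \near \oo, forall i, i < k.+1 -> forall j, j < k.+1 -> k * k * a i n <= b j n.
    by apply: near_forall_ltn => i; apply: near_forall_ltn => j; apply: ab.
  case=> N _ HN; exists (maxn N k) => // n /=; rewrite geq_max => /andP[Nn kn].
  have [_ _ Kmax] := KP n; apply: Kmax => // m nm i j ik jk.
  by apply: HN => //=; apply: leq_trans nm.
pose c n := \max_(i < (K n).+1) a i n.
exists c, K; split=> //.
- move=> m n mn; apply/bigmax_leqP => i _.
  apply: (@leq_trans (a i n)); first exact: amono.
  have iK : i < (K n).+1 by apply: leq_trans (ltn_ord i) _; rewrite ltnS Kmono.
  exact: (leq_bigmax (Ordinal iK)).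
- move=> i; apply: filterS (Kunb i) => n iK.
  by rewrite -ltnS in iK; exact: (leq_bigmax (Ordinal iK)).
- move=> j; apply: filterS (Kunb j) => n jK.
  have [i ->] : {i : 'I_(K n).+1 | c n = a i n} by apply: eq_bigmax; rewrite card_ord.
  have [_ PK _] := KP n; apply: PK => //; exact: leq_ord.
Qed.

End Growth.

(** * A binary tree of nested gaps between growth rates *)

Section Tree.
Local Open Scope nat_scope.
Variables (T : Type) (lt : T -> T -> Prop).
Hypothesis lt_wf : well_founded lt.
Hypothesis lt_tr : forall x y z, lt x y -> lt y z -> lt x z.
Hypothesis lt_tot : forall x y, x <> y -> lt x y \/ lt y x.
Hypothesis lt_countable : forall x, countable [set y | lt y x].
Variables (a0 b0 : nat -> nat).
Hypothesis a0_mono : nondecreasing a0.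
Hypothesis a0b0 : negligible a0 b0.

Implicit Types (x y : set T) (u v w : T).

(* A node [(c, K)] splits the gap between [c] and [K^2 c] at [K c]. *)
Let node := ((nat -> nat) * (nat -> nat))%type.
Let mid (p : node) n := p.2 n * p.1 n.
Let top (p : node) n := p.2 n * p.2 n * p.1 n.
Let lower (p : node) (bit : Prop) := if pselect bit then mid p else p.1.
Let upper (p : node) (bit : Prop) := if pselect bit then top p else mid p.

Let fits u x (rec : forall v, lt v u -> node) : set node := [set p |
  [/\ nondecreasing p.1, nondecreasing p.2, unbounded p.2,
      dominated a0 p.1 /\ dominated (top p) b0 &
      forall v (vu : lt v u), dominated (lower (rec v vu) (x v)) p.1 /\
                              dominated (top p) (upper (rec v vu) (x v))]].

(** The set [x] is a branch: membership of [v] selects the upper half of the gap at [v]. The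
    recursion needs a total choice, so a fitting node is picked by [xget]; [tree_fits] shows
    afterwards that one exists, so the default [(a0, a0)] does no harm. *)
Let tree x : T -> node :=
  Fix lt_wf (fun=> node) (fun u rec => xget (a0, a0) (fits x rec)).

Let treeE x u : tree x u = xget (a0, a0) (fits x (fun v (_ : lt v u) => tree x v)).
Proof.
rewrite /tree Fix_eq // => v f g fg; congr (xget _ (fits _ _)).
by apply: functional_extensionality_dep => w; apply/funext => h.
Qed.

Let mid_top p : unbounded p.2 -> negligible (mid p) (top p).
Proof.
move=> pu k; apply: filterS (pu k) => n kp.
by rewrite /mid /top -mulnA leq_mul2r kp orbT.
Qed.

Let bot_mid p : unbounded p.2 -> negligible p.1 (mid p).
Proof. by move=> pu k; apply: filterS (pu k) => n kp; rewrite leq_mul2r kp orbT. Qed.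

Let lower_upper p b : unbounded p.2 -> negligible (lower p b) (upper p b).
Proof.
by move=> pu; rewrite /lower /upper; case: pselect => ?; [apply: mid_top|apply: bot_mid].
Qed.

Let bot_lower p b : unbounded p.2 -> dominated p.1 (lower p b).
Proof.
move=> pu; rewrite /lower; case: pselect => ?; first exact/negligibleW/bot_mid.
by apply: filterE.
Qed.

Let upper_top p b : unbounded p.2 -> dominated (upper p b) (top p).
Proof.
move=> pu; rewrite /upper; case: pselect => ?; last exact/negligibleW/mid_top.
by apply: filterE.
Qed.

Let lower_mono p b : nondecreasing p.1 -> nondecreasing p.2 -> nondecreasing (lower p b).
Proof.
move=> m1 m2; rewrite /lower; case: pselect => ? // m n mn.
by apply: leq_mul; [apply: m2|apply: m1].
Qed.

(** The gaps chosen below [u] are nested, so every lower edge among them is negligible against every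
    upper edge. As [u] has only countably many predecessors, [gap_fill] provides a node. *)
Let tree_fits x u : fits x (fun v (_ : lt v u) => tree x v) (tree x u).
Proof.
move: u; apply: (well_founded_ind lt_wf) => u IH.
rewrite [tree x u]treeE; apply: xgetPex.
pose lo v := lower (tree x v) (x v); pose hi v := upper (tree x v) (x v).
have lohi v : lt v u -> negligible (lo v) (hi v).
  by move=> /IH[_ _ pu _ _]; apply: lower_upper.
have lohi2 v w : lt v u -> lt w u -> negligible (lo v) (hi w).
  move=> vu wu; have [->|vw] := pselect (v = w); first exact: lohi.
  have [_ _ pv _ hv] := IH v vu; have [_ _ pw _ hw] := IH w wu.
  have [vltw|wltv] := lt_tot vw.
    have [h _] := hw v vltw; apply: dominated_negligible h _.
    by apply: dominated_negligible (lohi w wu); apply: bot_lower.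
  have [_ h] := hv w wltv; apply: negligible_dominated h.
  by apply: negligible_dominated (lohi v vu) _; apply: upper_top.
have a0hi v : lt v u -> negligible a0 (hi v).
  move=> vu; have [_ _ pv [av _] _] := IH v vu.
  apply: dominated_negligible av _; apply: dominated_negligible (lohi v vu).
  exact: bot_lower.
have lob0 v : lt v u -> negligible (lo v) b0.
  move=> vu; have [_ _ pv [_ bv] _] := IH v vu.
  apply: negligible_dominated bv; apply: negligible_dominated (lohi v vu) _.
  exact: upper_top.
(* [None] stands for the root gap between [a0] and [b0]. Index 0 is reserved for it, so that the new
   node respects the root gap even when [u] has no predecessor. *)
have [e [eP e0 eS]] : exists e : nat -> option T, [/\ forall i v, e i = Some v -> lt v u,
    e 0 = None & forall v, lt v u -> exists i, e i = Some v].
  have /countable_injP[f finj] := lt_countable u.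
  pose ex i v := lt v u /\ (f v).+1 = i.
  exists (fun i => if pselect (exists v, ex i v) is left h then Some (sval (cid h)) else None).
  split=> [i v||v vu].
  - by case: pselect => // h [<-]; have [] := svalP (cid h).
  - by case: pselect => // -[v []].
  - exists (f v).+1; case: pselect => [h|[]]; last by exists v.
    have [wu [fwv]] := svalP (cid h); congr Some.
    by apply: finj => //; rewrite inE.
pose a i := if e i is Some v then lo v else a0.
pose b i := if e i is Some v then hi v else b0.
have amono i : nondecreasing (a i).
  rewrite /a; case E : (e i) => [v|] //.
  by have [m1 m2 _ _ _] := IH v (eP _ _ E); apply: lower_mono.
have ab i j : negligible (a i) (b j).
  rewrite /a /b; case E : (e i) => [v|]; case E' : (e j) => [w|] //.
  - by apply: lohi2; [apply: eP E|apply: eP E'].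
  - by apply: lob0; apply: eP E.
  - by apply: a0hi; apply: eP E'.
have [c [K [cm Km Ku ac cb]]] := gap_fill amono ab.
exists (c, K); split=> //=.
  by split; [have := ac 0; rewrite /a e0|have := cb 0; rewrite /b e0].
move=> v vu; have [i ei] := eS v vu.
by split; [have := ac i; rewrite /a ei|have := cb i; rewrite /b ei].
Qed.

Let tree_restr x y u : (forall v, lt v u -> x v = y v) -> tree x u = tree y u.
Proof.
move: u; apply: (well_founded_ind lt_wf) => u IH xy; rewrite !treeE; congr (xget _ _).
have exy v : lt v u -> tree x v = tree y v.
  by move=> vu; apply: IH => // w wv; apply: xy; apply: lt_tr wv vu.
apply/funext => p; apply/propext; split=> -[h1 h2 h3 h4 h5]; split=> // v vu.
  by have := h5 v vu; rewrite xy // exy.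
by have := h5 v vu; rewrite xy // exy.
Qed.

(** [L x] collects the lower edges of the gaps along the branch [x], a chain by nestedness. Where
    two branches first part, one takes the lower half; all its lower edges are then negligible
    against the midpoint, which is a lower edge of the other branch. *)
Lemma growth_tree (t0 : T) : unbounded a0 -> exists L : set T -> set (nat -> nat),
  [/\ forall x, L x !=set0,
      forall x g, L x g -> [/\ nondecreasing g, unbounded g & dominated g b0],
      forall x g h, L x g -> L x h -> dominated g h \/ dominated h g &
      forall x y, x <> y ->
        (exists2 m, L y m & forall g, L x g -> negligible g m) \/
        (exists2 m, L x m & forall g, L y g -> negligible g m)].
Proof.
move=> a0u; pose lo x v := lower (tree x v) (x v).
pose hi x v := upper (tree x v) (x v).
have lo_lt x v w : lt v w -> dominated (lo x v) (lo x w).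
  move=> vw; have [_ _ pw _ /(_ v vw)[h _]] := tree_fits x w.
  by apply: dominated_trans h _; apply: bot_lower.
have hi_lt x v w : lt v w -> dominated (hi x w) (hi x v).
  move=> vw; have [_ _ pw _ /(_ v vw)[_ h]] := tree_fits x w.
  by apply: dominated_trans h; apply: upper_top.
have lohi x v : negligible (lo x v) (hi x v).
  by have [_ _ pu _ _] := tree_fits x v; apply: lower_upper.
exists (fun x => [set lo x v | v in setT]); split.
- by move=> x; exists (lo x t0), t0.
- move=> x _ [v _ <-]; have [m1 m2 pu [av vb] _] := tree_fits x v.
  split; first exact: lower_mono.
    by apply: unbounded_dominated (a0u) _; apply: dominated_trans av _; apply: bot_lower.
  apply: dominated_trans (negligibleW (lohi x v)) _.
  by apply: dominated_trans vb; apply: upper_top.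
- move=> x _ _ [v _ <-] [w _ <-]; have [->|/lt_tot[/lo_lt|/lo_lt]] := pselect (v = w).
  + by left; apply: filterE.
  + by left.
  + by right.
move=> x y xy.
have [v [nv vmin]] : exists v, x v <> y v /\ forall w, lt w v -> x w = y w.
  apply: contrapT => nex; apply: xy; apply/funext => v; apply: contrapT.
  move: v; apply: (well_founded_ind lt_wf) => v IH nv; apply: nex; exists v; split=> // w /IH.
  exact: contrapT.
have sep x' y' : tree x' v = tree y' v -> ~ x' v -> y' v ->
    exists2 m, [set lo y' u | u in setT] m &
      forall g, [set lo x' u | u in setT] g -> negligible g m.
  move=> e nx yv; exists (lo y' v); first by exists v.
  (* Both sides are the midpoint of the node shared by the two branches. *)
  have E : lo y' v = hi x' v.
    by rewrite /lo /hi /lower /upper -e; case: pselect => // ?; case: pselect.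
  move=> _ [u _ <-]; rewrite E; have [->//|/lt_tot[uv|vu]] := pselect (u = v).
    exact: dominated_negligible (lo_lt x' _ _ uv) _.
  exact: negligible_dominated (lohi x' u) (hi_lt _ _ _ vu).
have e := tree_restr vmin.
have [xv|xv] := pselect (x v); have [yv|yv] := pselect (y v).
- by case: nv; apply/propext.
- by right; apply: sep.
- by left; apply: sep.
- by case: nv; apply/propext.
Qed.

End Tree.

Lemma aleph1_scale : exists L : set aleph1 -> set (nat -> nat),
  [/\ forall x, L x !=set0,
      forall x g, L x g -> [/\ nondecreasing g, unbounded g & dominated g id],
      forall x g h, L x g -> L x h -> dominated g h \/ dominated h g &
      forall x y, x <> y ->
        (exists2 m, L y m & forall g, L x g -> negligible g m) \/
        (exists2 m, L x m & forall g, L y g -> negligible g m)].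
Proof.
have [lt [wf tr tot ctb]] := aleph1_order.
have [s [t0 _]] := aleph1_shift.
(* Filling the gap between 1 and [id] gives [K n * K n * c n <= n] eventually. The middle rate
   [K * c] is unbounded and still negligible against [id], so it can be the bottom of the root
   gap. *)
have [//||c [K [cm Km Ku c1 Kb]]] := @gap_fill (fun _ _ => 1%N) (fun _ n => n).
  by move=> _ _ k; exists k => // n /=; rewrite muln1.
pose a0 n := (K n * c n)%N.
have a0u : unbounded a0.
  by move=> k; apply: filterS2 (Ku k) (c1 0) => n kK c0; rewrite (leq_trans kK) // leq_pmulr.
have a0b : negligible a0 id.
  move=> k; apply: filterS2 (Ku k) (Kb 0) => n kK; apply: leq_trans.
  by rewrite -mulnA leq_mul2r kK orbT.
have a0m : nondecreasing a0 by move=> m n mn; apply: leq_mul; [apply: Km|apply: cm].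
exact (growth_tree wf tr tot ctb a0m a0b t0 a0u).
Qed.

(** * Ideals *)

Section IdealBasics.
Variable R : comNzRingType.
Implicit Types I J P M : set R.

Lemma idealP I :
  ideal I <-> I 0 /\ forall a u v, I u -> I v -> I (a * u + v).
Proof.
split=> -[I0 IM]; split.
- exact: set_mem.
- by move=> a u v /mem_set Iu /mem_set Iv; apply/set_mem/IM.
- exact: mem_set.
- by move=> a u v /set_mem Iu /set_mem Iv; apply/mem_set/IM.
Qed.

Lemma ideal0 I : ideal I -> I 0. Proof. by move=> /idealP[]. Qed.

Lemma idealD I u v : ideal I -> I u -> I v -> I (u + v).
Proof. by move=> /idealP[_ h] Iu Iv; rewrite -[u]mul1r; apply: h. Qed.

Lemma idealM I a u : ideal I -> I u -> I (a * u).
Proof. by move=> /idealP[I0 h] Iu; rewrite -[a * u]addr0; apply: h. Qed.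

Lemma idealMl I a u : ideal I -> I u -> I (u * a).
Proof. by rewrite mulrC; apply: idealM. Qed.

Lemma idealN I u : ideal I -> I u -> I (- u).
Proof. by move=> iI Iu; rewrite -mulN1r; apply: idealM. Qed.

Lemma idealB I u v : ideal I -> I u -> I v -> I (u - v).
Proof. by move=> iI Iu Iv; apply: idealD => //; apply: idealN. Qed.

Lemma ideal_sum I (T : Type) (r : seq T) (Q : pred T) (F : T -> R) :
  ideal I -> (forall i, Q i -> I (F i)) -> I (\sum_(i <- r | Q i) F i).
Proof.
by move=> iI h; elim/big_ind : _ => //; [apply: ideal0|move=> u v; apply: idealD].
Qed.

Lemma idealr_closedP I : idealr_closed [in I] <-> ideal I /\ ~ I 1.
Proof.
split=> [[I0 I1 IM]|[[I0 IM] I1]]; split=> //.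
- by move=> /mem_set; apply/negP.
- by apply/negP => /set_mem.
Qed.

Lemma prime_idealP P : prime_ideal P <->
  [/\ ideal P, ~ P 1 & forall u v, P (u * v) -> P u \/ P v].
Proof.
split=> [[/idealr_closedP[iP P1] h]|[iP P1 h]]; split=> //.
- by move=> u v /mem_set/h/orP[]/set_mem; [left|right].
- exact/idealr_closedP.
- by move=> u v /set_mem/h[] p; apply/orP; [left|right]; apply/mem_set.
Qed.

Lemma maximal_idealP M : maximal_ideal M <->
  [/\ ideal M, ~ M 1 & forall I, ideal I -> ~ I 1 -> M `<=` I -> I = M].
Proof.
split=> [[/idealr_closedP[iM M1] h]|[iM M1 h]]; split=> //.
- by move=> I iI I1; apply: h; apply/idealr_closedP.
- exact/idealr_closedP.
- by move=> I /idealr_closedP[]; apply: h.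
Qed.

Lemma prime_idealX P a k : prime_ideal P -> P (a ^+ k) -> P a.
Proof.
move=> /prime_idealP[_ P1 Pp]; elim: k => [//|k IH]; rewrite exprS.
by move=> /Pp[].
Qed.

Lemma prime_neq0 P : prime_ideal P -> P <> [set 0] -> exists2 x, P x & x != 0.
Proof.
move=> /prime_idealP[iP _ _] P0; apply: contrapT => nP; apply: P0.
apply/seteqP; split=> [x Px|x /= ->]; last exact: ideal0.
by apply: contrapT => /eqP x0; apply: nP; exists x.
Qed.

Lemma prime_idealr_prime (P : prime_idealr R) : prime_ideal [set` P].
Proof.
apply/prime_idealP; split.
- apply/idealP; split; first exact: idealr0.
  by move=> a u v /= Pu Pv; apply: rpredD => //; apply: idealMr.
- by move=> /=; rewrite idealr1.
- by move=> u v /=; rewrite prime_idealrM => /orP.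
Qed.

Lemma ideal_sub_total_bigcup (F : set (set R)) :
  F !=set0 -> F `<=` @ideal R -> total_on F subset -> ideal (\bigcup_(X in F) X).
Proof.
move=> [X FX] Fi Ft; apply/idealP; split; first by exists X => //; apply: ideal0 (Fi _ FX).
move=> a u v [Y FY Yu] [Z FZ Zv].
have [YZ|ZY] := Ft _ _ FY FZ.
  by exists Z => //; apply: idealD (Fi _ FZ) _ Zv; apply: idealM (Fi _ FZ) (YZ _ Yu).
by exists Y => //; apply: idealD (Fi _ FY) _ (ZY _ Zv); apply: idealM (Fi _ FY) Yu.
Qed.

(* The empty set is added to the family because [Zorn_bigcup] also asks for the
   union of the empty chain. *)
Lemma ideal_Zorn (Q : set R -> Prop) I :
  Q I -> (forall J, Q J -> ideal J) ->
  (forall F, F !=set0 -> F `<=` Q -> total_on F subset -> Q (\bigcup_(X in F) X)) ->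
  exists2 J, Q J & forall K, Q K -> J `<=` K -> K = J.
Proof.
move=> QI Qi Qc; have [F Fs Ft|J [QJ Jmax]] := @Zorn_bigcup R [set X | Q X \/ X = set0].
  have [[X [FX X0]]|F0] := pselect (exists X, F X /\ X <> set0); last first.
    right; apply/seteqP; split=> // x [X FX Xx]; apply: F0; exists X; split=> //.
    by move=> X0; rewrite X0 in Xx.
  left; have -> : \bigcup_(X in F) X = \bigcup_(X in [set X | F X /\ X <> set0]) X.
    apply/seteqP; split=> x [Y FY Yx]; exists Y => //; last by case: FY.
    by split=> // Y0; rewrite Y0 in Yx.
  apply: Qc; first by exists X.
    by move=> Y [/Fs[]].
  by move=> Y Z [FY _] [FZ _]; apply: Ft.
case: QJ => [QJ|J0].
  exists J => // K QK JK; apply/seteqP; split=> //; apply: contrapT => KJ.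
  by apply: (Jmax K); [split|left].
exfalso; apply: (Jmax I); last by left.
by rewrite J0; split=> // /(_ 0)/(_ (ideal0 (Qi _ QI))).
Qed.

Lemma exists_maximal I : ideal I -> ~ I 1 -> exists2 M, maximal_ideal M & I `<=` M.
Proof.
move=> iI I1.
have [|J [iJ _]//|F F0 Fs Ft|M [iM M1 IM] Mmax] :=
    @ideal_Zorn (fun J => [/\ ideal J, ~ J 1 & I `<=` J]) I.
- by split.
- split; first by apply: ideal_sub_total_bigcup => // X /Fs[].
    by move=> [X /Fs[_ X1 _] /X1].
  by case: F0 => X FX x Ix; exists X => //; have [_ _ ] := Fs X FX; apply.
exists M => //; apply/maximal_idealP; split=> // K iK K1 MK; apply: Mmax => //.
by split=> //; apply: subset_trans IM MK.
Qed.

Definition ideal_add I a : set R := [set z | exists r x, I x /\ z = r * a + x].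

Lemma ideal_addP I a : ideal I ->
  [/\ ideal (ideal_add I a), I `<=` ideal_add I a & ideal_add I a a].
Proof.
move=> iI; split.
- apply/idealP; split; first by exists 0, 0; rewrite mul0r addr0; split=> //; apply: ideal0.
  move=> b _ _ [r [x [Ix ->]]] [s [y [Iy ->]]].
  exists (b * r + s), (b * x + y); split; last by ring.
  by apply: idealD => //; apply: idealM.
- by move=> x Ix; exists 0, x; rewrite mul0r add0r.
- by exists 1, 0; rewrite mul1r addr0; split=> //; apply: ideal0.
Qed.

Lemma maximal_inv M a : maximal_ideal M -> ~ M a ->
  exists b, M (1 - b * a).
Proof.
move=> /maximal_idealP[iM M1 Mmax] Ma; have [iJ MJ Ja] := ideal_addP a iM.
have [[r [x [Mx e]]]|J1] := pselect (ideal_add M a 1).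
  by exists r; rewrite e addrAC subrr add0r.
by case: Ma; rewrite -(Mmax _ iJ J1 MJ).
Qed.

Lemma maximal_prime M : maximal_ideal M -> prime_ideal M.
Proof.
move=> mM; have /maximal_idealP[iM M1 _] := mM; apply/prime_idealP; split=> // u v Muv.
apply: contrapT => /not_orP[/(maximal_inv mM)[b Mb] Mv]; apply: Mv.
have -> : v = v * (1 - b * u) + b * (u * v) by ring.
by apply: idealD => //; apply: idealM.
Qed.

End IdealBasics.

(** * Prime ideals defined by growth rates *)

Section GrowthPrimes.
Variables (A : comNzRingType) (B : nat -> A -> nat -> Prop).
(* [B n f k] expresses that the value of [f] at the [n]-th of a sequence of
   valuations is at most [k], up to a bounded factor. *)
Hypothesis B_le : forall n f k l, (k <= l)%N -> B n f k -> B n f l.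
Hypothesis B0 : forall n k, ~ B n 0 k.
Hypothesis B1 : forall n, B n 1 0.
Hypothesis BM : forall n f g k l, B n f k -> B n g l -> B n (f * g) (k + l).
Hypothesis BMr : forall n f g k, B n (f * g) k -> B n g k.
Hypothesis BD : forall n f g k, B n (f + g) k -> B n f k \/ B n g k.
Hypothesis B_realized : forall g, nondecreasing g -> unbounded g -> dominated g id ->
  exists f, (\forall n \near \oo, B n f (2 * g n)) /\
            (\forall n \near \oo, forall k, B n f k -> (g n <= k)%N).

(** An element lies in [phi x] when its values, along the ultrafilter, exceed every multiple of
    every rate in [L x]. Multiples, and [L x] being a chain, make the complement closed under
    products; for sums, the ultrafilter decides which summand is small. *)
Lemma growth_primes : exists phi : set aleph1 -> set A,
  [/\ injective phi, forall x, prime_ideal (phi x),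
      forall x y, phi x `<=` phi y \/ phi y `<=` phi x &
      forall x f k, phi x f -> ~ \forall n \near \oo, B n f k].
Proof.
have [L [L0 Lg Ltot Lsep]] := aleph1_scale.
have [U [UU ooU]] := ultraFilterLemma eventually_filter.
have Uex X : U X -> exists n, X n by apply: filter_ex.
have US X Y : X `<=` Y -> U X -> U Y by apply: filterS.
have UI X Y : U X -> U Y -> U (X `&` Y) by apply: filterI.
have UC X : U X \/ U (~` X) by apply: in_ultra_setVsetC.
pose phi x : set A :=
  [set f | forall g k, L x g -> ~ U [set n | B n f (k * g n)]].
(* A rate [m] of [L y] above all of [L x] separates the two primes: an element realizing [m] has
   values too large for [L x] but at most [2 * m]. *)
have sep x y m : L y m -> (forall g, L x g -> negligible g m) ->
    phi y `<=` phi x /\ phi x <> phi y.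
  move=> Lm Lxm; split=> [f fy g k Lg' Uf|e].
    apply: (fy m 1%N Lm); apply: US (UI _ _ (ooU _ (Lxm g Lg' k)) Uf) => n [/= h].
    by rewrite mul1n; apply: B_le.
  have [mm mu mn] := Lg _ _ Lm; have [f [f1 f2]] := B_realized mm mu mn.
  suff : phi x f by rewrite e => /(_ m 2%N Lm); apply; exact: ooU.
  (* On a large set of indices [k.+1 * g n <= m n <= k * g n], against [g n > 0]. *)
  move=> g k Lg' Uf; have /Uex[n [[[/= Bn fn] kn] gn]] : U ([set n | B n f (k * g n)] `&`
      [set n | forall k, B n f k -> (m n <= k)%N] `&` [set n | (k.+1 * g n <= m n)%N] `&`
      [set n | (0 < g n)%N]).
    apply: (UI _ _); last by have [_ gu _] := Lg _ _ Lg'; apply: (ooU _ (gu 1%N)).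
    apply: (UI _ _); last by apply/ooU/Lxm.
    by apply: (UI _ _) => //; apply: ooU.
  have := leq_trans kn (fn _ Bn); rewrite mulSn -[leqRHS]add0n leq_add2r leqn0.
  by rewrite -leqn0 leqNgt gn.
exists phi; split.
- move=> x y e; apply: contrapT => /Lsep[[m Lm /(sep _ _ _ Lm)[_]]|[m Lm /(sep _ _ _ Lm)[_]]] //.
  by move/nesym.
- move=> x; apply/prime_idealP; split.
  + apply/idealP; split=> [g k _|a u v fu fv g k Lgx].
      by move=> /Uex[n /= /B0].
    move=> Uuv; have [Uu|Uu] := UC [set n | B n u (k * g n)].
      exact: fu Lgx Uu.
    apply: (fv g k Lgx); apply: US (UI _ _ Uuv Uu) => n [/= /BD[/BMr //|//]].
  + have [g Lgx] := L0 x; move=> /(_ g 0%N Lgx); apply; apply: filterE => n.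
    by rewrite /= mul0n; apply: B1.
  + move=> u v fuv; apply: contrapT => /not_orP[].
    move=> /existsNP[g /existsNP[k /not_implyP[Lgx /contrapT Uu]]].
    move=> /existsNP[h /existsNP[l /not_implyP[Lhx /contrapT Uv]]].
    have [c [Lc gc hc]] : exists c, [/\ L x c, dominated g c & dominated h c].
      have [gh|hg] := Ltot x g h Lgx Lhx.
        by exists h; split=> //; apply: filterE.
      by exists g; split=> //; apply: filterE.
    apply: (fuv c (k + l)%N Lc).
    have Uall := UI _ _ (UI _ _ Uu (ooU _ gc)) (UI _ _ Uv (ooU _ hc)).
    apply: US Uall => n [[/= Bu gn] [Bv hn]]; rewrite mulnDl.
    by apply: BM; [apply: B_le Bu|apply: B_le Bv]; rewrite leq_mul2l ?gn ?hn orbT.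
- move=> x y; have [->|/Lsep[[m Lm h]|[m Lm h]]] := pselect (x = y); first by left.
    by right; have [] := sep _ _ _ Lm h.
  by left; have [] := sep _ _ _ Lm h.
- move=> x f k fx Bf; have [g Lgx] := L0 x; have [_ gu _] := Lg _ _ Lgx.
  apply: (fx g 1%N Lgx); apply: ooU; apply: filterS2 Bf (gu k) => n Bn kg.
  by rewrite /= mul1n; apply: B_le Bn.
Qed.

End GrowthPrimes.

(** * Values given by orders in X modulo infinitely many primes *)

Section ResidueGrowth.
Variables (D : idomainType) (P : nat -> set D).
Hypothesis P_prime : forall n, prime_ideal (P n).
Hypothesis P_incomparable : forall i j, i <> j -> exists w, P i w /\ ~ P j w.
Hypothesis P_tail : forall N i, (i < N)%N ->
  exists z, (forall n, (N <= n)%N -> P n z) /\ ~ P i z.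

Let P_ideal n : ideal (P n). Proof. by have /prime_idealP[] := P_prime n. Qed.
Let PM n u v : P n (u * v) -> P n u \/ P n v.
Proof. by have /prime_idealP[_ _] := P_prime n; apply. Qed.

(** Prime avoidance, one index at a time: an [x] that lies in [P j] is corrected by adding a [y] in
    the tail primes and in the earlier [P i] but not in [P j]. Such a [y] is an element given by
    [P_tail] times one element of each earlier [P i] outside [P j]. *)
Lemma tail_prime_avoidance N :
  exists x, forall n, P n x <-> (N <= n)%N.
Proof.
suff H j : (j <= N)%N -> exists x, (forall n, (N <= n)%N -> P n x) /\
    forall i, (i < j)%N -> ~ P i x.
  have [x [xP nx]] := H N (leqnn N); exists x => n; split=> [Pn|/xP//].
  by rewrite leqNgt; apply/negP => /nx.
elim: j => [_|j IH jN]; first by exists 0; split=> // n _; apply: ideal0.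
have [x [xP nx]] := IH (ltnW jN).
have [Pjx|Pjx] := pselect (P j x); last first.
  by exists x; split=> // i; rewrite ltnS leq_eqVlt => /orP[/eqP ->|/nx].
have [y [yP yj Pjy]] : exists y, [/\ forall n, (N <= n)%N -> P n y,
    forall i, (i < j)%N -> P i y & ~ P j y].
  suff K l : (l <= j)%N -> exists y, [/\ forall n, (N <= n)%N -> P n y,
      forall i, (i < l)%N -> P i y & ~ P j y] by apply: K.
  elim: l => [_|l IHl lj]; first by have [z [zP Pz]] := P_tail jN; exists z; split.
  have [y [yP yl Pjy]] := IHl (ltnW lj).
  have [|w [Pw Pjw]] := @P_incomparable l j; first by move=> e; rewrite e ltnn in lj.
  exists (y * w); split; last by move=> /PM[].
    by move=> n /yP; apply: idealMl.
  move=> i; rewrite ltnS leq_eqVlt => /orP[/eqP ->|/yl Py].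
    exact: idealM.
  exact: idealMl.
exists (x + y); split=> [n nN|i].
  by apply: idealD => //; [apply: xP|apply: yP].
rewrite ltnS leq_eqVlt => /orP[/eqP -> Pxy|ij Pxy].
  by apply: Pjy; rewrite -(addKr x y) addrC; apply: idealB.
by apply: (nx i ij); rewrite -(addrK y x); apply: idealB => //; apply: yj.
Qed.

Lemma residue_growth_primes : exists phi : set aleph1 -> set (fps D),
  [/\ injective phi, forall x, prime_ideal (phi x),
      forall x y, phi x `<=` phi y \/ phi y `<=` phi x &
      forall x f k, phi x f -> ~ \forall n \near \oo, ~ P n (f k)].
Proof.
pose B n (f : fps D) k := exists2 i, (i <= k)%N & ~ P n (f i).
have [||||||g gm gu _|phi [phi_inj phi_prime phi_tot phiB]] := @growth_primes (fps D) B.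
- by move=> n f k l kl [i ik Pi]; exists i => //; apply: leq_trans kl.
- move=> n k [i _]; rewrite /= if_same; apply; exact: ideal0.
- by move=> n; exists 0 => //=; have /prime_idealP[] := P_prime n.
- have least n (f : fps D) k : B n f k -> exists i, [/\ (i <= k)%N, ~ P n (f i) &
      forall j, (j < i)%N -> P n (f j)].
    move=> [i ik Pi]; have ex : exists i, `[< ~ P n (f i) >] by exists i; apply/asboolP.
    have [j /asboolP Pj jmin] := ex_minnP ex; exists j; split=> //.
      by apply: leq_trans ik; apply/jmin/asboolP.
    move=> l lj; apply: contrapT => Pl; have := jmin l; rewrite leqNgt lj => h.
    by have /h := asboolT Pl.
  move=> n f g k l /least[i [ik Pi imin]] /least[j [jl Pj jmin]].
  exists (i + j)%N; first exact: leq_add.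
  have ilt : (i < (i + j).+1)%N by rewrite ltnS leq_addr.
  rewrite /= (bigD1 (Ordinal ilt)) //= addKn => Ps.
  have : P n (f i * g j).
    rewrite -(addrK (\sum_(h < (i + j).+1 | h != Ordinal ilt) f h * g (i + j - h)%N) (f i * g j)).
    apply: idealB => //; apply: ideal_sum => // h; rewrite -val_eqE /= neq_ltn => /orP[hi|ih].
      by apply: idealMl => //; apply: imin.
    apply: idealM => //; apply: jmin; rewrite ltn_subLR; last by rewrite -ltnS.
    by rewrite ltn_add2r.
  by move=> /PM[].
- move=> n f g k [i ik Pi]; apply: contrapT => nB; apply: Pi.
  apply: ideal_sum => // h _; apply: idealM => //; apply: contrapT => Ph; apply: nB.
  by exists (i - h)%N => //; apply: leq_trans ik; apply: leq_subr.
- move=> n f g k [i ik Pi]; apply: contrapT => /not_orP[nf ng]; apply: Pi.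
  by apply: idealD => //; apply: contrapT => Ph; [apply: nf|apply: ng]; exists i.
(* As [g] is nondecreasing and unbounded, [g n <= k] holds on an initial segment of indices.
   Choosing [c k] outside [P n] exactly for those [n] makes the order modulo [P n] equal to
   [g n]. *)
- have exN k : exists N, forall n, (g n <= k)%N <-> (n < N)%N.
    have ex : exists n, (k < g n)%N by have [N _ h] := gu k.+1; exists N; apply: (h N) => /=.
    have [N kN Nmin] := ex_minnP ex; exists N => n; rewrite ltnNge; split=> [gk|].
      by apply/negP => /gm Nn; have := leq_trans kN (leq_trans Nn gk); rewrite ltnn.
    by move=> /negP nN; rewrite leqNgt; apply/negP => /Nmin.
  have [N NP] := choice exN.
  have [c cP] := choice (fun k => tail_prime_avoidance (N k)).
  have cg k n : ~ P n (c k) <-> (g n <= k)%N.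
    rewrite NP ltnNge; split=> [h|/negP h Pn]; first by apply/negP => /(cP k n).2.
    by apply: h; apply/(cP k n).1.
  exists (Fps c); split; apply: filterE => n.
    by exists (g n); [rewrite mul2n -addnn leq_addr|apply/cg].
  by move=> k [i ik /cg]; move=> h; apply: leq_trans ik.
exists phi; split=> // x f k fx Pf; apply: (phiB x f k fx).
by apply: filterS Pf => n Pn; exists k.
Qed.

End ResidueGrowth.

(** * Nondiscrete localizations *)

Section LocalDivisibility.
Variables (D : idomainType) (M : set D).
Hypothesis M_prime : prime_ideal M.

(* Divisibility in the localization at [M], for elements of [D]. *)
Definition ldvd (a b : D) := exists s y, ~ M s /\ s * b = y * a.

Let M_ideal : ideal M. Proof. by have /prime_idealP[] := M_prime. Qed.
Let M1 : ~ M 1. Proof. by have /prime_idealP[] := M_prime. Qed.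
Let MM u v : ~ M u -> ~ M v -> ~ M (u * v).
Proof. by have /prime_idealP[_ _ h] := M_prime; move=> Mu Mv /h[]. Qed.
Let nz s : ~ M s -> s != 0.
Proof. by move=> Ms; apply/eqP => s0; apply: Ms; rewrite s0; apply: ideal0. Qed.

Lemma ldvdd a : ldvd a a. Proof. by exists 1, 1. Qed.

Lemma ldvdr0 a : ldvd a 0. Proof. by exists 1, 0; rewrite mulr0 mul0r. Qed.

Lemma ldvd_trans b a c : ldvd a b -> ldvd b c -> ldvd a c.
Proof.
move=> [s [y [Ms e]]] [t [z [Mt e']]]; exists (s * t), (y * z); split; first exact: MM.
by rewrite -mulrA e' mulrCA e mulrA [y * z]mulrC.
Qed.

Lemma ldvd_mulr a b c : ldvd a b -> ldvd a (b * c).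
Proof. by move=> [s [y [Ms e]]]; exists s, (y * c); rewrite mulrA e mulrAC. Qed.

Lemma ldvd_mull a b c : ldvd a b -> ldvd a (c * b).
Proof. by rewrite mulrC; apply: ldvd_mulr. Qed.

Lemma ldvd_mul a b c d : ldvd a b -> ldvd c d -> ldvd (a * c) (b * d).
Proof.
move=> [s [y [Ms e]]] [t [z [Mt e']]]; exists (s * t), (y * z); split; first exact: MM.
by rewrite mulrACA e e' mulrACA.
Qed.

Lemma ldvd_cancel c a b : c != 0 -> ldvd (a * c) (b * c) -> ldvd a b.
Proof.
move=> c0 [s [y [Ms]]]; rewrite !mulrA => /(mulIf c0) e; exists s, y.
by split.
Qed.

Lemma ldvd_neq0 a b : b != 0 -> ldvd a b -> a != 0.
Proof.
move=> b0 [s [y [Ms e]]]; apply: contra_eq_neq e => ->; rewrite mulr0.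
by rewrite mulf_neq0 // nz.
Qed.

Lemma ldvd_irrefl a y : a != 0 -> M y -> ~ ldvd (y * a) a.
Proof.
move=> a0 My [s [z [Ms]]]; rewrite mulrA => /(mulIf a0) e; apply: Ms.
by rewrite e; apply: idealM.
Qed.

Hypothesis ldvd_total : forall a b, ldvd a b \/ ldvd b a.

Lemma ldvd_addl a b c : ldvd (a + b) c -> ldvd a c \/ ldvd b c.
Proof.
move=> h; have [[s [y [Ms e]]]|[s [y [Ms e]]]] := ldvd_total a b; [left|right].
  apply: ldvd_trans h; exists s, (s + y); split=> //.
  by rewrite mulrDr e mulrDl.
apply: ldvd_trans h; exists s, (s + y); split=> //.
by rewrite mulrDr e mulrDl addrC.
Qed.

Lemma ldvd_suml (T : Type) (r : seq T) (Q : pred T) (F : T -> D) c : c != 0 ->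
  ldvd (\sum_(i <- r | Q i) F i) c -> exists2 i, Q i & ldvd (F i) c.
Proof.
move=> c0; elim/big_rec : _ => [/(ldvd_neq0 c0)/eqP//|i x Qi IH].
by move=> /ldvd_addl[h|/IH//]; exists i.
Qed.

Lemma ldvd_bigmin (F : nat -> D) k :
  exists2 i, (i <= k)%N & forall j, (j <= k)%N -> ldvd (F i) (F j).
Proof.
elim: k => [|k [i ik imin]].
  by exists 0 => // j; rewrite leqn0 => /eqP ->; apply: ldvdd.
have [h|h] := ldvd_total (F i) (F k.+1).
  exists i => [|j]; first exact: leqW.
  by rewrite leq_eqVlt => /orP[/eqP -> //|]; rewrite ltnS; apply: imin.
exists k.+1 => // j; rewrite leq_eqVlt => /orP[/eqP -> |]; first exact: ldvdd.
by rewrite ltnS => /imin; apply: ldvd_trans.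
Qed.

Section Content.
Variable d : D.
Hypotheses (Md : M d) (d0 : d != 0).

(* In the valuation ring at [M], [d ^+ k] lies in the content of [f(dX)]. *)
Let B (f : fps D) k := exists i, ldvd (f i * d ^+ i) (d ^+ k).

Let dX k : d ^+ k != 0. Proof. exact: expf_neq0. Qed.

(** Coefficients have nonnegative value and [d] has positive value, so terms of index above [k] have
    value above that of [d ^+ k]. This reduces minima over all indices to finite ones. *)
Lemma content_leq (f : fps D) i k : ldvd (f i * d ^+ i) (d ^+ k) -> (i <= k)%N.
Proof.
move=> h; rewrite leqNgt; apply/negP => ki.
apply: (@ldvd_irrefl (d ^+ k) (f i * d ^+ (i - k))) => //.
  apply: idealM => //; rewrite -(prednK (n := i - k)) ?subn_gt0 //.
  by rewrite exprS; apply: idealMl.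
by rewrite -mulrA -exprD subnK // ltnW.
Qed.

Lemma content_addl f g k : B (f + g) k -> B f k \/ B g k.
Proof.
move=> [i]; rewrite /= mulrDl => /ldvd_addl[h|h]; [left|right]; by exists i.
Qed.

Lemma content_mulr f g k : B (f * g) k -> B g k.
Proof.
move=> [i]; rewrite /= mulr_suml => /(ldvd_suml (dX k))[j _ h].
exists (i - j)%N; apply: ldvd_trans h.
have -> : f j * g (i - j)%N * d ^+ i = f j * d ^+ j * (g (i - j)%N * d ^+ (i - j)).
  by rewrite mulrACA -exprD subnKC // -ltnS.
exact/ldvd_mull/ldvdd.
Qed.

Let content_attained f k : B f k -> exists i, [/\ ldvd (f i * d ^+ i) (d ^+ k),
  forall j, ldvd (f i * d ^+ i) (f j * d ^+ j) &
  forall j, (j < i)%N -> ~ ldvd (f j * d ^+ j) (f i * d ^+ i)].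
Proof.
move=> [l hl]; pose F i := f i * d ^+ i.
have [i0 i0k i0min] := ldvd_bigmin F k.
have i0d : ldvd (F i0) (d ^+ k) by apply: ldvd_trans (hl); apply/i0min/(content_leq hl).
have i0all j : ldvd (F i0) (F j).
  have [jk|kj] := leqP j k; first exact: i0min.
  apply: ldvd_trans i0d _; apply: ldvd_mull.
  by rewrite -(subnK (ltnW kj)) exprD; apply/ldvd_mull/ldvdd.
have ex : exists i, `[< ldvd (F i) (F i0) >] by exists i0; apply/asboolP/ldvdd.
have [i /asboolP ii0 imin] := ex_minnP ex; exists i; split.
- exact: ldvd_trans i0d.
- by move=> j; apply: ldvd_trans (i0all j).
move=> j ji h; have := imin j; rewrite leqNgt ji => H.
by have := H (asboolT (ldvd_trans h ii0)).
Qed.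

(* As in Gauss's lemma, the first coefficients of least value multiply to a term
   of strictly least value in the corresponding coefficient of the product. *)
Lemma content_mul f g k l : B f k -> B g l -> B (f * g) (k + l).
Proof.
move=> /content_attained[i [ik iall imin]] /content_attained[j [jl jall jmin]].
exists (i + j)%N; rewrite [d ^+ (k + l)]exprD.
apply: (@ldvd_trans ((f i * d ^+ i) * (g j * d ^+ j))); last exact: ldvd_mul.
set T := _ * _ * _.
have T0 : T != 0.
  by apply: mulf_neq0; [apply: ldvd_neq0 ik|apply: ldvd_neq0 jl].
have ilt : (i < (i + j).+1)%N by rewrite ltnS leq_addr.
set S := (f * g) _ * _.
have TE : T = S + \sum_(h < (i + j).+1 | h != Ordinal ilt)
    - (f h * d ^+ h * (g (i + j - h)%N * d ^+ (i + j - h)%N)).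
  rewrite /S /= mulr_suml (bigD1 (Ordinal ilt)) //= addKn exprD sumrN.
  rewrite [X in _ + X - _](eq_bigr (fun h : 'I_(i + j).+1 => f h * d ^+ h *
    (g (i + j - h)%N * d ^+ (i + j - h)%N))) ?addrK => [|h _].
    by rewrite /T; ring.
  have {1}-> : d ^+ i * d ^+ j = d ^+ h * d ^+ (i + j - h).
    by rewrite -!exprD subnKC // -ltnS.
  by ring.
(* [T] divides itself, so it is divisible by the coefficient [S] or by one of the other terms. A
   term dividing [T] has at most its value and contradicts the choice of [i] or [j]. *)
have := ldvdd T; rewrite {1}TE => /ldvd_addl[//|h].
have [h' + {}h] := ldvd_suml T0 h; rewrite -val_eqE /= neq_ltn.
set a := f h' * d ^+ h' in h; set b := g _ * _ in h.
have {}h : ldvd (a * b) T by apply: ldvd_trans h; exists 1, (-1); rewrite mulN1r mul1r.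
have a0 : a * b != 0 by apply: ldvd_neq0 h.
move=> /orP[hi|ih]; exfalso.
  apply: (imin _ hi); apply: (@ldvd_cancel (g j * d ^+ j)).
    by apply: ldvd_neq0 jl.
  by apply: ldvd_trans h; apply: ldvd_mul; [apply: ldvdd|apply: jall].
have hj : (i + j - h' < j)%N.
  by rewrite ltn_subLR ?ltn_add2r // -ltnS.
apply: (jmin _ hj); apply: (@ldvd_cancel (f i * d ^+ i)).
  by apply: ldvd_neq0 ik.
rewrite -/b ![_ * (f i * _)]mulrC; apply: ldvd_trans h.
by apply: ldvd_mul; [apply: iall|apply: ldvdd].
Qed.

End Content.

Hypothesis M_nontrivial : exists2 d, M d & d != 0.
Hypothesis M_split : forall d, M d -> d != 0 ->
  exists s y z, [/\ ~ M s, M y, M z & s * d = y * z].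

(** A first splitting gives exponent 1 with a cofactor in [M]. Then the base [e] is split in turn,
    and the square of its factor of smaller value divides [e], which doubles the exponent. *)
Lemma divided_power d n : M d -> d != 0 ->
  exists e, [/\ M e, e != 0 & exists s y, [/\ ~ M s, M y & s * d = y * e ^+ n]].
Proof.
move=> Md d0.
suff [j nj [e [Me e0 [s [y [Ms My E]]]]]] : exists2 j, (n < j)%N &
    exists e, [/\ M e, e != 0 & exists s y, [/\ ~ M s, M y & s * d = y * e ^+ j]].
  exists e; split=> //; exists s, (y * e ^+ (j - n)); split=> //; first exact: idealMl.
  by rewrite E -mulrA -exprD subnK // ltnW.
elim: n => [|n [j nj [e [Me e0 [s [y [Ms My E]]]]]]].
  exists 1%N => //; have [s [y [z [Ms My Mz E]]]] := M_split Md d0.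
  exists z; split=> //; last by exists s, y.
  by apply: contraNneq (mulf_neq0 (nz Ms) d0) => z0; rewrite E z0 mulr0.
exists (2 * j)%N; first by rewrite mul2n -addnn -addn1 leq_add // (leq_trans _ nj).
have [w [Mw w0 [t [z [Mt Et]]]]] : exists w, [/\ M w, w != 0 &
    exists s y, ~ M s /\ s * e = y * w ^+ 2].
  have [t [u [v [Mt Mu Mv Et]]]] := M_split Me e0.
  have := mulf_neq0 (nz Mt) e0; rewrite Et mulf_eq0 negb_or => /andP[u0 v0].
  have [[r [z [Mr Er]]]|[r [z [Mr Er]]]] := ldvd_total u v.
    exists u; split=> //; exists (r * t), z; split; first exact: MM.
    by rewrite -mulrA Et mulrCA Er; ring.
  exists v; split=> //; exists (r * t), z; split; first exact: MM.
  by rewrite -mulrA Et mulrA Er; ring.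
exists w; split=> //; exists (t ^+ j * s), (z ^+ j * y); split; last first.
- by rewrite -mulrA E mulrCA -exprMn Et exprMn exprM; ring.
- exact: idealM.
by apply: MM => //; elim: (j) => [|i IH]; rewrite ?expr0 // exprS; apply: MM.
Qed.

Lemma content_growth_primes : exists phi : set aleph1 -> set (fps D),
  [/\ injective phi, forall x, prime_ideal (phi x),
      forall x y, phi x `<=` phi y \/ phi y `<=` phi x &
      forall x f k, phi x f -> M (f k)].
Proof.
have [d0 Md0 nzd0] := M_nontrivial.
pose N := {x : D | M x /\ x != 0}.
have nextP (n : nat) (x : N) : exists e : N, exists s y,
    [/\ ~ M s, M y & s * sval x = y * sval e ^+ n].
  case: x => x [Mx x0]; have [e [Me e0 h]] := divided_power n Mx x0.
  by exists (exist _ e (conj Me e0)).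
pose next n x := sval (cid (nextP n x)).
(* The exponent grows with the index: measured by [d n], earlier elements have value above [n] and
   later ones at most 1. *)
pose dN := fix dN n : N := if n is n'.+1 then next n (dN n') else exist _ d0 (conj Md0 nzd0).
pose d n := sval (dN n).
have Md n : M (d n) by have [] := svalP (dN n).
have d_neq0 n : d n != 0 by have [] := svalP (dN n).
have dS n : exists s y, [/\ ~ M s, M y & s * d n = y * d n.+1 ^+ n.+1].
  exact: svalP (cid (nextP n.+1 (dN n))).
have d_ldvd m n : (m <= n)%N -> ldvd (d n) (d m).
  move=> /subnK <-; elim: (n - m)%N => [|k IH]; first exact: ldvdd.
  rewrite addSn; apply: ldvd_trans IH; have [s [y [Ms _ E]]] := dS (k + m)%N.
  by exists s, (y * d (k + m).+1 ^+ (k + m)); split=> //; rewrite E exprSr mulrA.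
have d_nldvd n j : ldvd (d n) (d n.+1 ^+ j) -> (n.+1 < j)%N.
  move=> h; rewrite ltnNge; apply/negP => jn; have [s [y [Ms My E]]] := dS n.
  have : ldvd (y * d n.+1 ^+ n.+1) (d n.+1 ^+ n.+1).
    apply: (@ldvd_trans (d n)); first by exists s, 1; rewrite mul1r E.
    apply: ldvd_trans h _.
    have -> : d n.+1 ^+ n.+1 = d n.+1 ^+ (n.+1 - j) * d n.+1 ^+ j by rewrite -exprD subnK.
    exact/ldvd_mull/ldvdd.
  by apply: ldvd_irrefl => //; apply: expf_neq0.
pose B n (f : fps D) k := exists i, ldvd (f i * d n ^+ i) (d n ^+ k).
have [||||||g gm gu gn|phi [phi_inj phi_prime phi_tot phiB]] := @growth_primes (fps D) B.
- move=> n f k l kl [i h]; exists i; apply: ldvd_trans h _.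
  by rewrite -(subnK kl) exprD; apply/ldvd_mull/ldvdd.
- move=> n k [i]; rewrite /= if_same mul0r => /ldvd_neq0.
  by rewrite expf_neq0 // eqxx => /(_ isT).
- by move=> n; exists 0; rewrite /= mul1r; apply: ldvdd.
- by move=> n f h k l; apply: content_mul.
- by move=> n f h k; apply: content_mulr.
- by move=> n f h k; apply: content_addl.
(* [N] is the last index with [g N <= k], or 0 if there is none. *)
- have exN k : exists N, ((N == 0) || (g N <= k))%N /\ forall n, (g n <= k)%N -> (n <= N)%N.
    have ex : exists n, ((n == 0) || (g n <= k))%N by exists 0.
    have [m _ hm] := gu k.+1.
    have bd n : ((n == 0) || (g n <= k))%N -> (n <= m)%N.
      move=> /orP[/eqP -> //|gk]; rewrite leqNgt; apply/negP => mn.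
      by have := hm n (ltnW mn); rewrite /= ltnNge gk.
    have [l pl lmax] := ex_maxnP ex bd.
    by exists l; split=> // n gk; apply: lmax; rewrite gk orbT.
  have [r rP] := choice exN.
  (* At [n], the term of index [g n] has a coefficient of value at most 1, hence total value at most
     [2 * g n]. For [i < g n] one has [r i < n], so the coefficient alone has value above
     [n >= g n]. *)
  exists (Fps (fun k => d (r k))); split.
    apply: filterS (gu 1%N) => n gn0; exists (g n) => /=.
    rewrite mul2n -addnn exprD; apply: ldvd_mul; last exact: ldvdd.
    apply: (@ldvd_trans (d n)); first by apply: d_ldvd; apply: (rP _).2.
    by rewrite -(prednK gn0) exprS; apply/ldvd_mulr/ldvdd.
  apply: filterS2 gn (unbounded_id 1%N) => n gn n0 k [i] /= h.
  have ik := (@content_leq _ (Md n) (d_neq0 n) (Fps (fun k => d (r k))) _ _ h).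
  rewrite leqNgt; apply/negP => kg.
  have rin : (r i < n)%N.
    rewrite ltnNge; apply/negP => nri; have [/orP[/eqP r0|gri] _] := rP i.
      by move: n0; rewrite ltnNge -r0 nri.
    by have := leq_trans (gm _ _ nri) gri; rewrite leqNgt (leq_ltn_trans ik kg).
  have {}h : ldvd (d (r i)) (d n ^+ (k - i)).
    by apply: (@ldvd_cancel (d n ^+ i)); [apply: expf_neq0|rewrite -exprD subnK].
  have : ldvd (d n.-1) (d n.-1.+1 ^+ (k - i)).
    by rewrite prednK //; apply: ldvd_trans h; apply: d_ldvd; rewrite -ltnS prednK.
  move=> /d_nldvd; rewrite prednK // ltnNge (leq_trans (leq_subr _ _)) //.
  exact: leq_trans (ltnW kg) gn.
(* A coefficient [f k] outside [M] is a unit at [M], which bounds the value of [f] by [k] at every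
   [n]. *)
exists phi; split=> // x f k fx; apply: contrapT => Mf; apply: (phiB x f k fx).
by apply: filterE => n; exists k, (f k), 1; rewrite mul1r.
Qed.

End LocalDivisibility.

(** * Noetherian and Dedekind domains *)

Section Noetherian.
Variable R : comNzRingType.
Implicit Types I J : set R.

Lemma ideal_span_ideal (G : set R) : ideal (ideal_span G).
Proof.
apply/idealP; split=> [I [iI _]|a u v hu hv I [iI GI]]; first exact: ideal0.
by apply: idealD => //; [apply: idealM => //; apply: hu|apply: hv].
Qed.

Lemma sub_ideal_span (G : set R) : G `<=` ideal_span G.
Proof. by move=> x Gx I [_]; apply. Qed.

Lemma ideal_span_min (G I : set R) : ideal I -> G `<=` I -> ideal_span G `<=` I.
Proof. by move=> iI GI x; apply. Qed.

Lemma ideal_span_seqP (s : seq R) x :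
  ideal_span [set` s] x <-> exists c : nat -> R, x = \sum_(i < size s) c i * s`_i.
Proof.
split=> [|[c ->]]; last first.
  have iG := ideal_span_ideal [set` s].
  apply: (ideal_sum _ iG) => i _; apply: (idealM _ iG).
  by apply: sub_ideal_span => /=; apply: mem_nth.
pose J : set R := [set x | exists c : nat -> R, x = \sum_(i < size s) c i * s`_i].
apply: (@ideal_span_min _ J).
  apply/idealP; split; first by exists (fun=> 0); rewrite big1 // => i _; rewrite mul0r.
  move=> a _ _ [c ->] [d ->]; exists (fun i => a * c i + d i).
  rewrite mulr_sumr -big_split /=; apply: eq_bigr => i _.
  by rewrite mulrDl mulrA.
move=> y /= ys; have yi : (index y s < size s)%N by rewrite index_mem.
exists (fun i => (i == index y s)%:R); rewrite (bigD1 (Ordinal yi)) //= eqxx mul1r nth_index //.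
by rewrite big1 ?addr0 // => i; rewrite -val_eqE /= => /negbTE ->; rewrite mul0r.
Qed.

Lemma total_bigcup_seq (F : set (set R)) (s : seq R) : F !=set0 ->
  total_on F subset -> [set` s] `<=` \bigcup_(X in F) X ->
  exists2 X, F X & [set` s] `<=` X.
Proof.
move=> F0 Ft; elim: s => [_|x s IH xs]; first by case: F0 => X FX; exists X.
have [|X FX sX] := IH; first by move=> y ys; apply: xs; rewrite /= inE [y \in s]ys orbT.
have [|Y FY Yx] := xs x; first by rewrite /= mem_head.
have [XY|YX] := Ft _ _ FX FY; [exists Y|exists X] => //.
  by move=> y /=; rewrite inE => /orP[/eqP ->//|/sX/XY].
by move=> y /=; rewrite inE => /orP[/eqP ->|/sX//]; apply: YX.
Qed.

Hypothesis R_noeth : noetherian R.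

Lemma noetherian_max (Q : set R -> Prop) I : Q I -> (forall J, Q J -> ideal J) ->
  exists2 J, Q J & forall K, Q K -> J `<=` K -> K = J.
Proof.
move=> QI Qi; apply: (ideal_Zorn QI Qi) => F F0 FQ Ft.
have iU := ideal_sub_total_bigcup F0 (fun X FX => Qi X (FQ X FX)) Ft.
have [s sE] := R_noeth iU.
have [|X FX sX] := total_bigcup_seq (s := s) F0 Ft.
  by rewrite sE; apply: sub_ideal_span.
suff -> : \bigcup_(X in F) X = X by apply: FQ.
apply/seteqP; split; last by move=> x Xx; exists X.
by rewrite sE; apply: ideal_span_min => //; apply/Qi/FQ.
Qed.

Lemma noetherian_acc (I : nat -> set R) : (forall n, ideal (I n)) ->
  (forall n, I n `<=` I n.+1) -> exists n, forall m, (n <= m)%N -> I m = I n.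
Proof.
move=> Ii IS; have [||J [n _ <-] Jmax] := @noetherian_max (fun J => range I J) (I 0).
- by exists 0.
- by move=> _ [n _ <-].
exists n => m nm; apply: Jmax; first by exists m.
rewrite -(subnK nm); elim: (m - n)%N => [|k IH] //; rewrite addSn.
exact: subset_trans IH (IS _).
Qed.

End Noetherian.

(** * Dedekind domains at a nonzero prime *)

Section DedekindLocal.
Variable (R : idomainType) (M : set R).
Hypotheses (R_dedekind : dedekind R) (M_prime : prime_ideal M).
Hypothesis M_neq0 : exists2 c, M c & c != 0.

Let M_ideal : ideal M. Proof. by have /prime_idealP[] := M_prime. Qed.
Let M1 : ~ M 1. Proof. by have /prime_idealP[] := M_prime. Qed.
Let MM u v : ~ M u -> ~ M v -> ~ M (u * v).
Proof. by have /prime_idealP[_ _ h] := M_prime; move=> Mu Mv /h[]. Qed.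
Let nz s : ~ M s -> s != 0.
Proof. by move=> Ms; apply/eqP => s0; apply: Ms; rewrite s0; apply: ideal0. Qed.

(* A colon ideal [(c : b)] maximal among those contained in [M] is prime, hence
   equal to [M]. *)
Lemma dedekind_colon : exists b c, c != 0 /\
  forall x, M x <-> exists y, x * b = y * c.
Proof.
have [R_noeth _ R_dim] := R_dedekind; have [c Mc c0] := M_neq0.
pose colon b : set R := [set x | exists y, x * b = y * c].
have colon_ideal b : ideal (colon b).
  apply/idealP; split; first by exists 0; rewrite !mul0r.
  move=> a u v [y hy] [z hz]; exists (a * y + z).
  by rewrite !mulrDl -!mulrA hy hz.
have [||_ [[b _ <-] bM] bmax] := @noetherian_max _ R_noeth
    (fun J => range colon J /\ J `<=` M) (colon 1).
- split; first by exists 1.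
  by move=> x [y]; rewrite mulr1 => ->; apply: idealM.
- by move=> _ [[b _ <-] _]; apply: colon_ideal.
have cb : colon b c by exists b; rewrite mulrC.
have sub a : ~ M a -> colon (a * b) `<=` M.
  move=> Ma t [y ty]; have : colon b (t * a) by exists y; rewrite -mulrA.
  by move=> /bM; have /prime_idealP[_ _ h] := M_prime; case/h.
have colon_mul a : colon b `<=` colon (a * b).
  by move=> x [y xy]; exists (a * y); rewrite mulrCA xy mulrA.
have colonE a : colon (a * b) `<=` M -> colon (a * b) = colon b.
  by move=> aM; apply: bmax => //; split=> //; exists (a * b).
have p : prime_ideal (colon b).
  apply/prime_idealP; split=> // [/bM //|u v uv].
  have [uM|] := pselect (colon (u * b) `<=` M).
    by right; rewrite -(colonE u uM); case: uv => y e; exists y; rewrite mulrA [v * u]mulrC.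
  move=> /existsNP[s /not_implyP[[y sub_] Ms]]; left.
  rewrite -(colonE s (sub s Ms)); exists y.
  by rewrite mulrA [u * s]mulrC -mulrA.
have nz0 : colon b <> [set 0].
  by move=> e; move: cb; rewrite e => /= c00; rewrite c00 eqxx in c0.
have /maximal_idealP[_ _ mx] := R_dim _ p nz0.
by exists b, c; split=> // x; rewrite (mx _ M_ideal M1 bM).
Qed.

(** As [M] is the colon ideal of [c] by [b], multiplication by [b / c] sends [M] into the ring. If
    it sends some [m] of [M] outside [M], then [m] generates [M] locally. *)
Lemma dedekind_uniformizer : exists m s, [/\ M m, m != 0, ~ M s &
  forall x, M x -> exists y, x * s = y * m].
Proof.
have [R_noeth R_int R_dim] := R_dedekind.
have [b [c [c0 ME]]] := dedekind_colon.
have [[m [s [Mm Ms ms]]]|nex] :=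
    pselect (exists m s, [/\ M m, ~ M s & m * b = s * c]).
  have m0 : m != 0.
    apply: contraNneq (mulf_neq0 (nz Ms) c0) => m0.
    by rewrite -ms m0 mul0r.
  exists m, s; split=> // x /ME[y xy]; exists y; apply: (mulIf c0).
  by rewrite -mulrA -ms mulrCA xy; ring.
(* Otherwise [b / c] maps [M] into itself and is integral. *)
have Mc : M c by apply/ME; exists b; rewrite mulrC.
have next (x : {x | M x}) : exists y : {y | M y}, sval x * b = sval y * c.
  case: x => x Mx; have /ME[y xy] := Mx; suff My : M y by exists (exist _ y My).
  by apply: contrapT => My; apply: nex; exists x, y.
(* [z i] is [c] times the [i]-th power of [b / c], and lies in [M]. Once the spans of the first [n]
   of them stop growing, expressing [z n] through its predecessors gives a monic equation for
   [b / c]. *)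
pose z := fix z n := if n is n'.+1 then sval (cid (next (z n'))) else exist _ c Mc.
have zS n : sval (z n) * b = sval (z n.+1) * c by apply: (svalP (cid (next (z n)))).
pose zs n := mkseq (fun i => sval (z i)) n.
pose I n := ideal_span [set` zs n].
have zI n i : (i < n)%N -> I n (sval (z i)).
  move=> ni; apply: sub_ideal_span; apply/mapP; exists i => //.
  by rewrite mem_iota.
have [||n nstab] := @noetherian_acc _ R_noeth I.
- by move=> n; apply: ideal_span_ideal.
- move=> n; apply: ideal_span_min; first exact: ideal_span_ideal.
  move=> x /mapP[i]; rewrite mem_iota add0n /= => ni ->; apply: zI.
  exact: leqW.
have : I n.+1 (sval (z n)) by apply: zI.
rewrite (nstab n.+1) // => /ideal_span_seqP[r]; rewrite size_mkseq => rE.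
pose u : {fraction R} := tofrac b / tofrac c.
have tc0 : tofrac c != 0 by rewrite tofrac_eq0.
have uc : u * tofrac c = tofrac b by rewrite divfK.
have zE i : tofrac (sval (z i)) = u ^+ i * tofrac c.
  elim: i => [|i IH]; first by rewrite expr0 mul1r.
  apply: (mulIf tc0); rewrite -tofracM -zS tofracM IH -uc.
  by rewrite mulrACA exprSr !mulrA.
pose q : {poly R} := \poly_(i < n) r i.
have : integralOver (@tofrac R) u.
  exists ('X^n - q).
    by rewrite monicE lead_coefDl ?lead_coefXn // size_polyN size_polyXn ltnS size_poly.
  apply/rootP; rewrite rmorphB /= map_polyXn hornerD hornerN hornerXn.
  apply/eqP; rewrite subr_eq0; apply/eqP; apply: (mulIf tc0).
  rewrite -zE rE rmorph_sum /= /q poly_def rmorph_sum horner_sum mulr_suml /=.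
  apply: eq_bigr => i _; rewrite nth_mkseq // map_polyZ map_polyXn hornerZ hornerXn.
  by rewrite tofracM zE mulrA.
move=> /R_int[x ux]; exfalso; apply: M1; apply/ME; exists x.
by apply/eqP; rewrite mul1r -tofrac_eq tofracM -ux uc.
Qed.

(** While the quotient [y] lies in [M] it can be divided by [m] once more, at the cost of a factor
    [s]. Each division strictly enlarges the contracted local ideal [sat y], so noetherianity ends
    the process. *)
Lemma dedekind_valuation : exists m, [/\ M m, m != 0 &
  forall x, x != 0 -> exists k t u, [/\ ~ M t, ~ M u & x * u = t * m ^+ k]].
Proof.
have [R_noeth _ _] := R_dedekind; have [m [s [Mm m0 Ms ms]]] := dedekind_uniformizer.
exists m; split=> // x x0; pose sat y : set R := [set z | exists w a, ~ M w /\ w * z = a * y].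
pose Q J := exists y i, J = sat y /\ x * s ^+ i = y * m ^+ i.
have sat_ideal y : ideal (sat y).
  apply/idealP; split; first by exists 1, 0; rewrite mulr0 mul0r.
  move=> a u v [w [e [Mw we]]] [w' [e' [Mw' we']]]; exists (w * w'), (a * e * w' + e' * w).
  split; first exact: MM.
  have -> : (a * e * w' + e' * w) * y = a * w' * (e * y) + w * (e' * y) by ring.
  by rewrite -we -we'; ring.
have [||_ [y [i [-> E]]] ymax] := @noetherian_max _ R_noeth Q (sat x).
- by exists x, 0; rewrite !expr0.
- by move=> _ [y [i [-> _]]].
have [My|My] := pselect (M y); last first.
  exists i, y, (s ^+ i); split=> //.
  by elim: (i) => [|j IH]; rewrite ?expr0 // exprS; apply: MM.
have [y' E'] := ms y My.
have Ex : x * s ^+ i.+1 = y' * m ^+ i.+1.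
  by rewrite exprSr mulrA E mulrAC E' exprS; ring.
have sub : sat y `<=` sat y'.
  move=> z [w [a [Mw wz]]]; exists (s * w), (a * m); split; first exact: MM.
  by rewrite -mulrA wz -[a * m * y']mulrA [m * y']mulrC -E'; ring.
have satE : sat y' = sat y by apply: ymax => //; exists y', i.+1.
have : sat y' y' by exists 1, 1.
rewrite satE => -[w [a [Mw wy]]]; exfalso; apply: (MM Mw Ms).
have y'0 : y' != 0.
  have : x * s ^+ i.+1 != 0 by rewrite mulf_neq0 // expf_neq0 // nz.
  by apply: contraNneq => y'0; rewrite Ex y'0 mul0r.
have -> : w * s = a * m; last exact: idealM.
apply: (mulIf y'0); have -> : w * s * y' = w * y' * s by ring.
by rewrite wy -mulrA E'; ring.
Qed.

Lemma dedekind_ldvd_total a b : ldvd M a b \/ ldvd M b a.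
Proof.
have [m [Mm m0 val]] := dedekind_valuation.
have [->|a0] := eqVneq a 0; first by right; apply: ldvdr0.
have [->|b0] := eqVneq b 0; first by left; apply: ldvdr0.
have [k [t [u [Mt Mu E]]]] := val a a0; have [l [t' [u' [Mt' Mu' E']]]] := val b b0.
suff H c d i j p q p' q' : ~ M p -> ~ M q -> ~ M p' -> ~ M q' -> (i <= j)%N ->
    c * q = p * m ^+ i -> d * q' = p' * m ^+ j -> ldvd M c d.
  have [kl|/ltnW lk] := leqP k l; [left|right].
    exact: H Mt Mu Mt' Mu' kl E E'.
  exact: H Mt' Mu' Mt Mu lk E' E.
move=> Mp Mq Mp' Mq' ij cq dq; exists (q' * p), (p' * m ^+ (j - i) * q); split; first exact: MM.
have -> : q' * p * d = d * q' * p by ring.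
have -> : p' * m ^+ (j - i) * q * c = p' * m ^+ (j - i) * (c * q) by ring.
by rewrite dq cq -[in LHS](subnK ij) exprD; ring.
Qed.

Lemma dedekind_ldvd_archimedean x d : x != 0 -> M d -> exists k, ldvd M x (d ^+ k).
Proof.
have [m [Mm m0 val]] := dedekind_valuation => x0 Md.
have [->|d0] := eqVneq d 0; first by exists 1%N; rewrite expr1; apply: ldvdr0.
have [k [t [u [Mt Mu E]]]] := val x x0; have [l [t' [u' [Mt' Mu' E']]]] := val d d0.
have l0 : (0 < l)%N.
  rewrite lt0n; apply/eqP => l0; apply: (Mt'); move: E'; rewrite l0 expr0 mulr1 => <-.
  exact: idealMl.
(* [d] has order [l >= 1] at [M], so [d ^+ k] has order [l * k >= k], the order of [x]. *)
exists k; exists (u' ^+ k * t), (t' ^+ k * m ^+ (l * k - k) * u); split.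
  by apply: MM => //; elim: (k) => [|j IH]; rewrite ?expr0 // exprS; apply: MM.
have -> : u' ^+ k * t * d ^+ k = (d * u') ^+ k * t by rewrite exprMn; ring.
have -> : t' ^+ k * m ^+ (l * k - k) * u * x = t' ^+ k * m ^+ (l * k - k) * (x * u) by ring.
have mE : m ^+ (l * k) = m ^+ (l * k - k) * m ^+ k by rewrite -exprD subnK // leq_pmull.
by rewrite E E' exprMn -exprM mE; ring.
Qed.

End DedekindLocal.

Lemma fractionP (R : idomainType) (u : {fraction R}) :
  exists a b, b != 0 /\ u = tofrac a / tofrac b.
Proof.
elim/quotW: u => x; have d0 := denom_ratioP x; exists \n_x, \d_x; split=> //.
have td0 : tofrac \d_x != 0 by rewrite tofrac_eq0.
apply: (mulIf td0); rewrite divfK //; unlock FracField.tofrac.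
rewrite -[LHS]FracField.pi_mul; apply/eqmodP => /=.
by rewrite FracField.equivfE /FracField.mulf !numden_Ratio ?mulf_neq0 ?oner_neq0 ?mulr1 // mulrC.
Qed.

(** The multipliers of [u] into the ring form an ideal; were it proper, it would lie in a maximal
    [M]. Then [u = s / y] with [y] in [M] and [s] outside, and clearing denominators in the monic
    equation puts a power of [s] into [M]. *)
Lemma locally_valuation_integrally_closed (R : idomainType) :
  (forall (M : set R) a b, maximal_ideal M -> ldvd M a b \/ ldvd M b a) ->
  integrally_closed R.
Proof.
move=> R_total u [p p_monic /rootP pu]; have [a [b [b0 uE]]] := fractionP u.
have tb0 : tofrac b != 0 by rewrite tofrac_eq0.
pose I : set R := [set r | exists y, r * a = y * b].
suff [y] : I 1.
  by rewrite mul1r => ab; exists y; rewrite uE ab tofracM mulfK.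
apply: contrapT => I1; have [|M mM IM] := exists_maximal _ I1.
  apply/idealP; split; first by exists 0; rewrite !mul0r.
  move=> c v w [y hy] [z hz]; exists (c * y + z).
  by rewrite !mulrDl -!mulrA hy hz.
have pM := maximal_prime mM; have /prime_idealP[iM _ _] := pM.
have [[s [y [Ms sb]]]|[s [y [Ms sa]]]] := R_total M a b mM; last first.
  by apply/Ms/IM; exists y.
have My : M y by apply: IM; exists s.
have yu : tofrac y * u = tofrac s.
  by apply: (mulIf tb0); rewrite uE mulrA divfK // -!tofracM sb.
have p_gt0 : (0 < size p)%N by rewrite size_poly_gt0 monic_neq0.
pose k := (size p).-1; have kE : size p = k.+1 by rewrite prednK.
have H : \sum_(i < k.+1) p`_i * s ^+ i * y ^+ (k - i) = 0.
  apply/eqP; rewrite -tofrac_eq0 rmorph_sum /=; apply/eqP.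
  transitivity (tofrac y ^+ k * (map_poly (@tofrac R) p).[u]); last by rewrite pu mulr0.
  rewrite (@horner_coef_wide _ k.+1); last by rewrite -kE size_poly.
  rewrite mulr_sumr.
  apply: eq_bigr => i _; rewrite coef_map /= !tofracM !tofracXn -yu exprMn.
  have -> : tofrac y ^+ k = tofrac y ^+ (k - i) * tofrac y ^+ i.
    by rewrite -exprD subnK // -ltnS.
  by ring.
apply: Ms; apply: (@prime_idealX _ _ _ k pM).
move: H; rewrite big_ord_recr /= subnn expr0 mulr1.
have -> : p`_k = 1 by have /monicP := p_monic; rewrite lead_coefE.
rewrite mul1r => /eqP; rewrite addr_eq0 => /eqP e; rewrite -[s ^+ k]opprK -e.
apply: idealN => //; apply: (ideal_sum _ iM) => i _; apply: idealM => //.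
have -> : (k - i = (k - i).-1.+1)%N by rewrite prednK // subn_gt0.
by rewrite exprS; apply: idealMl.
Qed.

Section Cohen.
Variable R : comNzRingType.

(** An ideal [J] maximal among the non-finitely generated ones is prime: if [u * v] is in [J] but
    neither factor is, then [J + (u)] and the colon ideal [C] of [J] by [u] are finitely generated.
    The [J]-components of generators of the former and [u] times those of the latter generate
    [J]. *)
Lemma Cohen_noetherian :
  (forall P : set R, prime_ideal P -> exists s : seq R, P = ideal_span [set` s]) ->
  noetherian R.
Proof.
pose fg (I : set R) := exists s : seq R, I = ideal_span [set` s].
move=> primes_fg I iI; apply: contrapT => nI.
have [||F F0 FQ Ft|J [iJ nJ] Jmax] := @ideal_Zorn _ (fun J => ideal J /\ ~ fg J) I.
- by split.
- by move=> J [].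
- have iU := ideal_sub_total_bigcup F0 (fun X FX => (FQ X FX).1) Ft; split=> // -[s sE].
  have [|X FX sX] := total_bigcup_seq (s := s) F0 Ft.
    by rewrite sE; apply: sub_ideal_span.
  have [iX nX] := FQ X FX; apply: nX; exists s; apply/seteqP; split.
    by rewrite -sE => x Xx; exists X.
  exact: ideal_span_min.
have fg_above K : ideal K -> J `<=` K -> K <> J -> fg K.
  by move=> iK JK KJ; apply: contrapT => nK; apply: KJ; apply: Jmax.
apply: (nJ); apply: primes_fg; apply/prime_idealP; split=> // [J1|u v Juv].
  apply: (nJ); exists [:: 1]; apply/seteqP; split=> x _; last first.
    by rewrite -[x]mulr1; apply: idealM.
  rewrite -[x]mulr1; apply: (idealM _ (ideal_span_ideal _)).
  by apply: sub_ideal_span; rewrite /= inE.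
apply: contrapT => /not_orP[Ju Jv]; apply: (nJ).
have [iA JA Au] := ideal_addP u iJ.
have [s sE] : fg (ideal_add J u) by apply: fg_above => // e; rewrite e in Au.
pose C : set R := [set r | J (r * u)].
have iC : ideal C.
  apply/idealP; split; first by rewrite /C /= mul0r; apply: ideal0.
  move=> a x y; rewrite /C /= => hx hy; rewrite mulrDl -mulrA.
  by apply: idealD => //; apply: idealM.
have [t tE] : fg C.
  apply: fg_above => // [x Jx|e]; first exact: idealMl.
  by apply: Jv; rewrite -e /C /= mulrC.
have exX w : exists x, ideal_add J u w -> J x /\ exists r, w = r * u + x.
  have [[r [x [Jx e]]]|n] := pselect (ideal_add J u w); last by exists 0.
  by exists x => _; split=> //; exists r.
have [X XP] := choice exX.
pose G := map X s ++ map (fun w => w * u) t; exists G.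
have iG := ideal_span_ideal [set` G].
have CG : C `<=` [set r | ideal_span [set` G] (r * u)].
  rewrite tE; apply: ideal_span_min.
    apply/idealP; split; first by rewrite /= mul0r; apply: (ideal0 iG).
    by move=> a x y /= hx hy; rewrite mulrDl -mulrA; apply: (idealD iG) => //; apply: (idealM _ iG).
  move=> w wt; apply: sub_ideal_span => /=.
  by rewrite mem_cat; apply/orP; right; apply: map_f.
have GJ : ideal_span [set` G] `<=` J.
  apply: ideal_span_min => // x; rewrite /= mem_cat => /orP[|] /mapP[w ws ->].
    have wA : ideal_add J u w by rewrite sE; apply: sub_ideal_span.
    by have [] := XP w wA.
  have : C w by rewrite tE; apply: sub_ideal_span.
  by [].
apply/seteqP; split=> // z Jz.
have [iH _ _] := ideal_addP u iG.
have : ideal_add (ideal_span [set` G]) u z.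
  suff : ideal_add J u `<=` ideal_add (ideal_span [set` G]) u by apply; apply: JA.
  rewrite sE; apply: ideal_span_min => // w ws.
  have wA : ideal_add J u w by rewrite sE; apply: sub_ideal_span.
  have [_ [r e]] := XP w wA.
  exists r, (X w); split=> //; apply: sub_ideal_span => /=.
  by rewrite mem_cat; apply/orP; left; apply: map_f.
move=> [r [k [Gk e]]]; rewrite e; apply: (idealD iG) => //; apply: CG.
by rewrite /C /= -(addrK k (r * u)) -e; apply: idealB => //; apply: GJ.
Qed.

End Cohen.

(** * Systems of Dedekind domains *)

Section SubringVal.
Variables (R : idomainType) (S : subringClosed R).
Implicit Types x y : subring S.

Lemma subring_val0 : subring_val (0 : subring S) = 0. Proof. exact: (rmorph0 val). Qed.
Lemma subring_val1 : subring_val (1 : subring S) = 1. Proof. exact: (rmorph1 val). Qed.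
Lemma subring_valD x y : subring_val (x + y) = subring_val x + subring_val y.
Proof. exact: (rmorphD val). Qed.
Lemma subring_valB x y : subring_val (x - y) = subring_val x - subring_val y.
Proof. exact: (rmorphB val). Qed.
Lemma subring_valM x y : subring_val (x * y) = subring_val x * subring_val y.
Proof. exact: (rmorphM val). Qed.
Lemma subring_valX x k : subring_val (x ^+ k) = subring_val x ^+ k.
Proof. exact: (rmorphXn val). Qed.
Lemma subring_val_sum n (F : 'I_n -> subring S) :
  subring_val (\sum_(i < n) F i) = \sum_(i < n) subring_val (F i).
Proof. exact: (rmorph_sum val). Qed.
Lemma subring_val_inj : injective (@subring_val R S). Proof. exact: val_inj. Qed.
Lemma subring_val_eq0 x : (subring_val x == 0) = (x == 0).
Proof. by rewrite -[RHS](inj_eq subring_val_inj) subring_val0. Qed.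

End SubringVal.

Section SystemUnion.
Variables (D : idomainType) (Dn : nat -> subringClosed D).
Hypothesis Dn_system : dedekind_system Dn.
Hypothesis D_union : forall x : D, exists n, x \in Dn n.

Lemma system_mono i j : (i <= j)%N -> {subset Dn i <= Dn j}.
Proof.
move=> /subnK <-; elim: (j - i)%N => [|k IH] // x /IH; rewrite addSn.
exact: (system_subset Dn_system).
Qed.

Lemma system_common (s : seq D) m :
  exists2 n, (m <= n)%N & forall x, x \in s -> x \in Dn n.
Proof.
elim: s => [|x s [n mn sn]]; first by exists m.
have [k xk] := D_union x; exists (maxn n k); first by rewrite leq_max mn.
move=> y; rewrite inE => /orP[/eqP ->|/sn].
  by apply: system_mono xk; apply: leq_maxr.
by apply: system_mono; apply: leq_maxl.
Qed.

(** A nonunit of the first ring lies in a maximal ideal there, and survival of this ideal in every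
    later ring prevents an inverse from appearing in the union. *)
Lemma system_nonunit : exists x : D, x != 0 /\ forall y, y * x != 1.
Proof.
have /existsNP[x /not_implyP[x0 xu]] := @system_nonfield _ _ Dn_system 0%N.
pose I : set (subring (Dn 0%N)) := [set z | exists r, z = r * x].
have iI : ideal I.
  apply/idealP; split; first by exists 0; rewrite mul0r.
  by move=> a _ _ [r ->] [s ->]; exists (a * r + s); rewrite mulrDl mulrA.
have I1 : ~ I 1.
  by move=> [r e]; apply: xu; apply/unitrP; exists r; rewrite [x * r]mulrC -e.
have [P mP IP] := exists_maximal iI I1.
exists (subring_val x); split; first by rewrite subring_val_eq0.
(* The bound 1 forces a positive index, since survival starting from ring 0 concerns later rings
   only. *)
move=> y; apply/eqP => yx; have [n + yn] := system_common [:: y] 1.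
have {}yn : y \in Dn n by apply: yn; rewrite inE.
case: n yn => // n yn _; have := @system_survive _ _ Dn_system 0%N n.+1 P isT mP.
apply; apply/seteqP; split=> // z _.
have xn : subring_val x \in Dn n.+1 by apply: (@system_mono 0%N) => //; case: (x).
have -> : z = (z * Subring yn) * Subring xn.
  by apply: subring_val_inj; rewrite !subring_valM -mulrA yx mulr1.
apply: (idealM _ (ideal_span_ideal _)).
apply: sub_ideal_span; exists x => //; apply: IP; exists 1.
by rewrite mul1r.
Qed.

Lemma maximal_neq0 (M : set D) : maximal_ideal M -> exists2 c, M c & c != 0.
Proof.
move=> mM; have [x [x0 xu]] := system_nonunit.
have [Mx|Mx] := pselect (M x); first by exists x.
have [b Mb] := maximal_inv mM Mx; exists (1 - b * x) => //.
by rewrite subr_eq0 eq_sym xu.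
Qed.

Section Trace.
Variable M : set D.
Hypotheses (M_prime : prime_ideal M) (M_neq0 : exists2 c, M c & c != 0).

Let trace n : set (subring (Dn n)) := [set x | M (subring_val x)].
Arguments trace : clear implicits.

Let trace_prime n : prime_ideal (trace n).
Proof.
have /prime_idealP[iM M1 Mp] := M_prime; apply/prime_idealP; split.
- apply/idealP; split; first by rewrite /trace /mkset subring_val0; apply: ideal0.
  move=> a u v; rewrite /trace /mkset => Mu Mv; rewrite subring_valD subring_valM.
  by apply: idealD => //; apply: idealM.
- by rewrite /trace /mkset subring_val1.
- by move=> u v; rewrite /trace /mkset subring_valM; apply: Mp.
Qed.

Let trace_neq0 (c : D) n : c \in Dn n -> M c -> c != 0 -> exists2 x, trace n x & x != 0.
Proof.
by move=> cn Mc c0; exists (Subring cn) => //; rewrite -subring_val_eq0.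
Qed.

Lemma system_ldvd n (a b : subring (Dn n)) :
  ldvd (trace n) a b -> ldvd M (subring_val a) (subring_val b).
Proof.
move=> [s [y [Ms e]]]; exists (subring_val s), (subring_val y); split=> //.
by rewrite -!subring_valM e.
Qed.

Lemma system_ldvd_total a b : ldvd M a b \/ ldvd M b a.
Proof.
(* The nonzero [c] of [M] is carried along so that the trace of [M] is nonzero. *)
have [c Mc c0] := M_neq0; have [n _ h] := system_common [:: a; b; c] 0.
have [an bn cn] : [/\ a \in Dn n, b \in Dn n & c \in Dn n].
  by split; apply: h; rewrite !inE eqxx ?orbT.
have [] := dedekind_ldvd_total (system_dedekind Dn_system n) (trace_prime n)
  (trace_neq0 cn Mc c0) (Subring an) (Subring bn) => /system_ldvd; by [left|right].
Qed.

Lemma system_ldvd_archimedean x d : x != 0 -> M d -> exists k, ldvd M x (d ^+ k).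
Proof.
move=> x0 Md; have [c Mc c0] := M_neq0; have [n _ h] := system_common [:: x; d; c] 0.
have [xn dn cn] : [/\ x \in Dn n, d \in Dn n & c \in Dn n].
  by split; apply: h; rewrite !inE eqxx ?orbT.
have [|k /system_ldvd] := @dedekind_ldvd_archimedean _ _ (system_dedekind Dn_system n)
    (trace_prime n) (trace_neq0 cn Mc c0) (Subring xn) (Subring dn) _ Md.
  by rewrite -subring_val_eq0.
by rewrite subring_valX /=; exists k.
Qed.

Lemma system_prime_maximal : maximal_ideal M.
Proof.
have /prime_idealP[iM M1 _] := M_prime; have [c Mc c0] := M_neq0.
apply/maximal_idealP; split=> // I iI I1 MI; apply/seteqP; split=> // x Ix.
apply: contrapT => Mx; apply: I1; have [n _ h] := system_common [:: x; c] 0.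
have [xn cn] : x \in Dn n /\ c \in Dn n by split; apply: h; rewrite !inE eqxx ?orbT.
have [_ _ dim1] := system_dedekind Dn_system n.
have mT : maximal_ideal (trace n).
  apply: dim1; first exact: trace_prime.
  have [z Tz z0] := trace_neq0 cn Mc c0 => e; move: Tz; rewrite e /= => z00.
  by rewrite z00 eqxx in z0.
have [|b] := maximal_inv (a := Subring xn) mT; first by [].
rewrite /trace /mkset subring_valB subring_val1 subring_valM /= => Mb.
have -> : 1 = (1 - subring_val b * x) + subring_val b * x by rewrite subrK.
by apply: idealD => //; [apply: MI|apply: idealM].
Qed.

Lemma system_trace_fg n : exists s : seq D, [set` s] `<=` M /\
  forall x, x \in Dn n -> M x -> ideal_span [set` s] x.
Proof.
have [noeth _ _] := system_dedekind Dn_system n.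
have /prime_idealP[iT _ _] := trace_prime n.
have [t tE] := noeth _ iT; exists (map (@subring_val _ _) t); split=> [_ /= /mapP[z zt ->]|x xn Mx].
  by have : trace n z by rewrite tE; apply: sub_ideal_span.
have : trace n (Subring xn) by [].
rewrite tE => /ideal_span_seqP[c e].
have -> : x = \sum_(i < size t) subring_val (c i) * subring_val t`_i.
  rewrite -[x]/(subring_val (Subring xn)) e subring_val_sum /=; apply: eq_bigr => i _.
  by rewrite -subring_valM.
have iS := ideal_span_ideal [set` map (@subring_val _ _) t]; apply: (ideal_sum _ iS) => i _.
apply: (idealM _ iS); apply: sub_ideal_span => /=; apply: map_f.
exact: mem_nth.
Qed.

End Trace.

Definition primes_below (M : set D) := exists phi : set aleph1 -> set (fps D),
  [/\ injective phi, forall x, prime_ideal (phi x),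
      forall x y, phi x `<=` phi y \/ phi y `<=` phi x &
      forall x f k, phi x f -> M (f k)].

Definition locally_principal (M : set D) :=
  exists d, [/\ M d, d != 0 & forall x, M x -> ldvd M d x].

Section Maximal.
Variable M : set D.
Hypothesis M_max : maximal_ideal M.

Let M_prime : prime_ideal M. Proof. exact: maximal_prime. Qed.
Let M_ideal : ideal M. Proof. by have /maximal_idealP[] := M_max. Qed.

(** [P n.+1] contains a trace of [M] large enough to include an element of [M] missing from [P n].
    All later choices contain this element too, which is the tail condition of
    [residue_growth_primes]. *)
Lemma shared_trace_primes :
  (forall n, exists P, [/\ maximal_ideal P, P <> M &
     forall x, x \in Dn n -> M x -> P x]) ->
  primes_below M.
Proof.
move=> shared.
pose good (p : nat * set D) := [/\ maximal_ideal p.2, p.2 <> M &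
  forall x, x \in Dn p.1 -> M x -> p.2 x].
pose S := {p | good p}.
have nextP (p : S) : exists q : S, ((sval p).1 < (sval q).1)%N /\
    exists z, [/\ z \in Dn (sval q).1, M z & ~ (sval p).2 z].
  case: p => -[n P] [/= mP PM _].
  have [z [Mz Pz]] : exists z, M z /\ ~ P z.
    apply: contrapT => nz; apply: PM; have /maximal_idealP[_ _ Mm] := M_max.
    have /maximal_idealP[iP P1 _] := mP; apply: Mm => // x Mx.
    by apply: contrapT => Px; apply: nz; exists x.
  have [m nm zm] := system_common [:: z] n.+1.
  have [Q [mQ QM QP]] := shared m.
  exists (exist good (m, Q) (And3 mQ QM QP)); split=> //=; exists z; split=> //.
  by apply: zm; rewrite inE.
have [P0 P0P] := shared 0.
pose q := fix q n : S := if n is n'.+1 then sval (cid (nextP (q n')))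
                         else exist good (0, P0) P0P.
pose ix n := (sval (q n)).1; pose P n := (sval (q n)).2.
have [P_max P_trace] : (forall n, maximal_ideal (P n)) /\
    (forall n x, x \in Dn (ix n) -> M x -> P n x).
  by split=> n; rewrite /P /ix; case: (sval (q n)) (svalP (q n)) => ? ? [].
have qS n : (ix n < ix n.+1)%N /\ exists z, [/\ z \in Dn (ix n.+1), M z & ~ P n z].
  exact: (svalP (cid (nextP (q n)))).
have ix_mono m n : (m <= n)%N -> (ix m <= ix n)%N.
  move=> /subnK <-; elim: (n - m)%N => // k IH; rewrite addSn.
  by apply: leq_trans IH _; apply/ltnW; have [] := qS (k + m)%N.
have ix_ge n : (n <= ix n)%N.
  by elim: n => // n IH; apply: leq_ltn_trans IH _; have [] := qS n.
have P_tail N i : (i < N)%N -> exists z, (forall n, (N <= n)%N -> P n z) /\ ~ P i z.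
  move=> iN; have [_ [z [zi Mz Pz]]] := qS i; exists z; split=> // n Nn.
  by apply: P_trace => //; apply: system_mono zi; apply/ix_mono/(leq_trans iN).
have P_neq i j : (i < j)%N -> P i <> P j.
  by move=> ij e; have [z [zP []]] := P_tail j i ij; rewrite e; apply: zP.
have P_inc i j : i <> j -> exists w, P i w /\ ~ P j w.
  move=> ij; apply: contrapT => nw.
  have e : P j = P i.
    have /maximal_idealP[_ _ h] := P_max i; have /maximal_idealP[? ? _] := P_max j.
    by apply: h => // x Pix; apply: contrapT => Pjx; apply: nw; exists x.
  by have [ji|ji|//] := ltngtP i j; [apply: P_neq ji _|apply: P_neq ji _].
have [phi [h1 h2 h3 h4]] := residue_growth_primes (fun n => maximal_prime (P_max n)) P_inc P_tail.
exists phi; split=> // x f k fx; apply: contrapT => Mf; apply: (h4 x f k fx).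
(* With [b] an inverse of [f k] modulo [M], the element [1 - b * f k] of [M] lies in almost all
   [P n], so [f k] is outside almost all of them. *)
have [b Mb] := maximal_inv M_max Mf; have [m bm] := D_union (1 - b * f k).
exists m => // n /= mn Pf; have /maximal_idealP[iP P1 _] := P_max n; apply: P1.
have -> : 1 = (1 - b * f k) + b * f k by rewrite subrK.
apply: idealD => //; last exact: idealM.
by apply: P_trace => //; apply: system_mono bm; apply: leq_trans (ix_ge n).
Qed.

(** If neither construction applies, some trace of [M] lies in no other maximal ideal, and some
    nonzero [d] in [M] is not locally a product of two elements of [M], so [d] generates [M] locally
    at [M]. *)
Lemma maximal_dichotomy :
  primes_below M \/
  (exists s : seq D, M = ideal_span [set` s]) /\ locally_principal M.
Proof.
have [|nshared] := pselect (forall n, exists P, [/\ maximal_ideal P, P <> M &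
     forall x, x \in Dn n -> M x -> P x]); first by move=> /shared_trace_primes; left.
have M0 := maximal_neq0 M_max.
have tot := system_ldvd_total M_prime M0.
have [split_|] := pselect (forall d, M d -> d != 0 ->
  exists s y z, [/\ ~ M s, M y, M z & s * d = y * z]).
  by left; apply: content_growth_primes tot M0 split_.
move=> /existsNP[d /not_implyP[Md /not_implyP[d0 nsplit]]]; right.
have Md_ldvd x : M x -> ldvd M d x.
  move=> Mx; have [//|[s [y [Ms e]]]] := tot d x.
  have [My|My] := pselect (M y); first by case: nsplit; exists s, y, x.
  by exists y, s.
split; last by exists d.
have /existsNP[n nP] := nshared.
have [t [tM tP]] := system_trace_fg M_prime n; exists (d :: t).
have iJ := ideal_span_ideal [set` d :: t]; apply/seteqP; split; last first.
  by apply: ideal_span_min => // x; rewrite /= inE => /orP[/eqP ->|/tM].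
have Jd : ideal_span [set` d :: t] d by apply: sub_ideal_span; rewrite /= mem_head.
have Jt x : x \in Dn n -> M x -> ideal_span [set` d :: t] x.
  move=> xn Mx; apply: (ideal_span_min _ _ (tP x xn Mx)) => // z zt.
  by apply: sub_ideal_span; rewrite /= inE [z \in t]zt orbT.
(* [I] collects the multipliers of [x] into the candidate ideal. A maximal ideal above [I] contains
   the trace, hence is [M]; but local generation by [d] puts an element outside [M] into [I]. *)
move=> x Mx; pose I : set D := [set r | ideal_span [set` d :: t] (r * x)].
suff : I 1 by rewrite /I /= mul1r.
have iI : ideal I.
  apply/idealP; split; first by rewrite /I /= mul0r; apply: (ideal0 iJ).
  move=> a u v; rewrite /I /= => hu hv; rewrite mulrDl -mulrA.
  by apply: (idealD iJ) => //; apply: (idealM _ iJ).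
apply: contrapT => I1; have [P mP IP] := exists_maximal iI I1.
have PM : P = M.
  apply: contrapT => PM; apply: nP; exists P; split=> // z zn Mz; apply: IP.
  by rewrite /I /=; apply: (idealMl _ iJ); apply: Jt.
have [s [y [Ms e]]] := Md_ldvd x Mx; apply: Ms; rewrite -PM; apply: IP.
by rewrite /I /= e; apply: (idealM _ iJ).
Qed.

End Maximal.

Lemma system_dedekindP :
  (forall M : set D, maximal_ideal M -> exists s : seq D, M = ideal_span [set` s]) ->
  dedekind D.
Proof.
move=> max_fg.
have max (P : set D) : prime_ideal P -> P <> [set 0] -> maximal_ideal P.
  by move=> pP P0; apply: system_prime_maximal => //; apply: prime_neq0.
split=> //.
- apply: Cohen_noetherian => P pP; have [P0|P0] := pselect (P = [set 0]); last exact/max_fg/max.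
  exists [::]; rewrite P0; apply/seteqP; split=> x.
    by move=> /= ->; apply: (ideal0 (ideal_span_ideal _)).
  apply: ideal_span_min => //; apply/idealP; split=> // a u v /= -> ->.
  by rewrite mulr0 addr0.
- apply: locally_valuation_integrally_closed => M a b mM.
  by apply: system_ldvd_total; [apply: maximal_prime|apply: maximal_neq0].
Qed.

Lemma system_not_dedekind : ~ dedekind D ->
  exists2 M : set D, maximal_ideal M & primes_below M.
Proof.
move=> nD; apply: contrapT => nM; apply/nD/system_dedekindP => M mM.
by have [h|[]//] := maximal_dichotomy mM; case: nM; exists M.
Qed.

End SystemUnion.

Lemma descending_sub (T : Type) (J : nat -> set T) :
  (forall n, J n.+1 `<=` J n) -> forall m n, (m <= n)%N -> J n `<=` J m.
Proof.
move=> JS m n /subnK <-; elim: (n - m)%N => [//|k IH]; rewrite addSn.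
exact: subset_trans (JS _) IH.
Qed.

(** * Power series over a Dedekind domain *)

Section DescendingChains.
Variable R : comNzRingType.
Hypotheses (R_noeth : noetherian R)
  (R_dim1 : forall P : set R, prime_ideal P -> P <> [set 0] -> maximal_ideal P).

Let dcc_above (I : set R) := forall J : nat -> set R, (forall n, ideal (J n)) ->
  (forall n, I `<=` J n) -> (forall n, J n.+1 `<=` J n) ->
  exists n, forall m, (n <= m)%N -> J m = J n.

(* Noetherian induction: a maximal counterexample is prime, hence maximal. *)
Lemma dim1_dcc (I : set R) : ideal I -> (exists2 c, I c & c != 0) -> dcc_above I.
Proof.
move=> iI [c Ic c0]; apply: contrapT => nI.
have [||J [iJ IJ nJ] Jmax] := @noetherian_max _ R_noeth
  (fun J => [/\ ideal J, I `<=` J & ~ dcc_above J]) I.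
- by split.
- by move=> J [].
have above K : ideal K -> J `<=` K -> K <> J -> dcc_above K.
  move=> iK JK KJ; apply: contrapT => nK; apply: KJ; apply: Jmax => //.
  by split=> //; apply: subset_trans JK.
have full (K : nat -> set R) n : (forall n, ideal (K n)) ->
    (forall n, K n 1) -> forall m, (n <= m)%N -> K m = K n.
  move=> iK K1 m _; apply/seteqP; split=> x _; rewrite -[x]mulr1.
    by apply: (idealM _ (iK n)).
  by apply: (idealM _ (iK m)).
have J1 : ~ J 1.
  by move=> J1; apply: (nJ) => K iK JK _; exists 0%N; apply: full => // n; apply: JK.
have [pJ|npJ] := pselect (prime_ideal J).
  have /maximal_idealP[_ _ mJ] : maximal_ideal J.
    by apply: R_dim1 => // J0; have := IJ _ Ic; rewrite J0 /= => c00; rewrite c00 eqxx in c0.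
  apply: (nJ) => K iK JK KS.
  have [|/existsNP[n Kn1]] := pselect (forall n, K n 1); first by exists 0%N; apply: full.
  exists n => m nm; have Kn : K n = J by apply: mJ.
  apply/seteqP; split; first exact: descending_sub.
  by rewrite Kn; apply: JK.
(* With [a * b] in [J], both [J + (a)] and the colon ideal of [J] by [a] are strictly larger than
   [J]. A descending chain above [J] stops once its sums with [(a)] and its colon ideals by [a] both
   do. *)
have [a [b [Jab Ja Jb]]] : exists a b, [/\ J (a * b), ~ J a & ~ J b].
  apply: contrapT => nab; apply: npJ; apply/prime_idealP; split=> // a b Jab.
  by apply: contrapT => /not_orP[Ja Jb]; apply: nab; exists a, b.
pose colon (K : set R) : set R := [set r | K (r * a)].
have colon_ideal K : ideal K -> ideal (colon K).
  move=> iK; apply/idealP; split; first by rewrite /colon /= mul0r; apply: (ideal0 iK).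
  move=> r u v; rewrite /colon /= => hu hv; rewrite mulrDl -mulrA.
  by apply: (idealD iK) => //; apply: (idealM _ iK).
apply: (nJ) => K iK JK KS.
have [iA JA Aa] := ideal_addP a iJ.
have [||||n1 h1] := above _ iA JA _ (fun n => ideal_add (K n) a).
- by move=> e; rewrite e in Aa.
- by move=> n; have [] := ideal_addP a (iK n).
- by move=> n _ [r [x [Jx ->]]]; exists r, x; split=> //; apply: JK.
- by move=> n _ [r [x [Kx ->]]]; exists r, x; split=> //; apply: KS.
have [|||||n2 h2] := above _ (colon_ideal _ iJ) _ _ (fun n => colon (K n)).
- by move=> x Jx; apply: idealMl.
- by move=> e; apply: Jb; rewrite -e /colon /= mulrC.
- by move=> n; apply: colon_ideal.
- by move=> n x; apply: JK.
- by move=> n x; apply: KS.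
exists (maxn n1 n2) => m; rewrite geq_max => /andP[n1m n2m].
apply/seteqP; split; first by apply: descending_sub => //; rewrite geq_max n1m.
move=> x Kx; set n := maxn n1 n2 in Kx *.
have nm : (n <= m)%N by rewrite geq_max n1m.
have [_ KA _] := ideal_addP a (iK n).
have e1 : ideal_add (K n) a = ideal_add (K m) a by rewrite (h1 m) // h1 // leq_maxl.
have e2 : colon (K n) = colon (K m) by rewrite (h2 m) // h2 // leq_maxr.
have := KA _ Kx; rewrite e1 => -[r [y [Ky xE]]].
have : colon (K n) r.
  rewrite /colon /= -(addrK y (r * a)) -xE; apply: (idealB (iK n)) => //.
  exact: (descending_sub KS nm).
by rewrite e2 xE => Kr; apply: (idealD (iK m)).
Qed.

End DescendingChains.

Section PowerSeries.
Variable D : idomainType.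
Implicit Types f g : fps D.

Definition fpsX : fps D := Fps (fun n => (n == 1)%:R).

Lemma fpsXM0 f : (fpsX * f) 0 = 0.
Proof. by rewrite /= big_ord_recl big_ord0 mul0r addr0. Qed.

Lemma fpsXMS f n : (fpsX * f) n.+1 = f n.
Proof.
rewrite /= big_ord_recl /= mul0r add0r big_ord_recl /= mul1r subSS subn0.
by rewrite big1 ?addr0 // => i _; rewrite mul0r.
Qed.

Lemma fpsX_dvd f : f 0 = 0 -> f = fpsX * Fps (fun n => f n.+1).
Proof. by move=> f0; apply: fpsP => -[|n]; rewrite ?fpsXM0 ?fpsXMS. Qed.

Lemma fps_mul0 f g : (f * g) 0 = f 0 * g 0.
Proof. by rewrite /= big_ord_recl big_ord0 addr0. Qed.

Lemma fps_coef0 n : (0 : fps D) n = 0. Proof. by rewrite /= if_same. Qed.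

Definition constants (I : set (fps D)) : set D := [set c | exists2 g, I g & g 0 = c].

Lemma constants_ideal I : ideal I -> ideal (constants I).
Proof.
move=> iI; apply/idealP; split; first by exists 0; [apply: (ideal0 iI)|].
move=> a _ _ [f If <-] [g Ig <-]; exists (fps_const a * f + g).
  by apply: (idealD iI) => //; apply: (idealM _ iI).
by rewrite -[LHS]/((fps_const a * f) 0 + g 0) fps_mul0.
Qed.

(* Division by generators of the constant terms of [J] is repeated on the
   [X]-quotients of the remainders; the quotients add up to power series. *)
Lemma constants_sub (I J : set (fps D)) : noetherian D -> ideal I -> ideal J ->
  J `<=` I -> (forall f, I (fpsX * f) -> I f) -> constants I `<=` constants J -> I `<=` J.
Proof.
move=> D_noeth iI iJ JI Isat IJ f If.
have [s sE] := D_noeth _ (constants_ideal iJ).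
have exG (i : nat) : exists g, J g /\ ((i < size s)%N -> g 0 = s`_i).
  have [si|is_] := leqP (size s) i.
    by exists 0; split=> //; apply: (ideal0 iJ).
  have [g Jg g0] : constants J s`_i.
    by rewrite sE; apply: sub_ideal_span => /=; apply: mem_nth.
  by exists g.
have [G GP] := choice exG.
have JG i : J (G i) by have [] := GP i.
have step (p : {f | I f}) : exists q : {f | I f} * (nat -> D),
    sval p = \sum_(i < size s) fps_const (q.2 i) * G i + fpsX * sval q.1.
  case: p => h Ih; have : constants J (h 0) by apply: IJ; exists h.
  rewrite sE => /ideal_span_seqP[c hc].
  pose r := h - \sum_(i < size s) fps_const (c i) * G i.
  have Ir : I r.
    apply: (idealB iI) => //; apply: (ideal_sum _ iI) => i _.
    by apply: (idealM _ iI); apply: JI.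
  have r0 : r 0 = 0.
    have sum0 n (F : 'I_n -> fps D) : (\sum_(i < n) F i) 0 = \sum_(i < n) (F i) 0.
      by elim/big_ind2 : _ => // [x1 x2 y1 y2 <- <-].
    rewrite -[LHS]/(h 0 - (\sum_(i < size s) fps_const (c i) * G i) 0) sum0 hc.
    rewrite -sumrB big1 // => i _; rewrite fps_mul0 /=.
    by have [_ ->] := GP i; rewrite ?subrr.
  have Iq : I (Fps (fun n => r n.+1)) by apply: Isat; rewrite -(fpsX_dvd r0).
  exists (exist _ _ Iq, c) => /=; rewrite -(fpsX_dvd r0) /r.
  by rewrite addrCA subrr addr0.
have [next nextP] := choice step.
pose p := fix p k := if k is k'.+1 then (next (p k')).1 else exist _ f If.
pose c k := (next (p k)).2.
pose C k i : fps D := Fps (fun l => c (k + l)%N i).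
have CE k i : C k i = fps_const (c k i) + fpsX * C k.+1 i.
  apply: fpsP => -[|n]; first by rewrite /= addn0 big_ord_recl big_ord0 mul0r !addr0.
  by rewrite -[RHS]/(0 + (fpsX * C k.+1 i) n.+1) fpsXMS add0r /= addSnnS.
(* [h k] is the error of the summed quotients at step [k]. It is [X] times [h k.+1], hence divisible
   by every power of [X], hence zero. *)
pose h k := sval (p k) - \sum_(i < size s) C k i * G i.
have hE k : h k = fpsX * h k.+1.
  have e : \sum_(i < size s) C k i * G i =
      \sum_(i < size s) fps_const (c k i) * G i + fpsX * \sum_(i < size s) C k.+1 i * G i.
    rewrite mulr_sumr -big_split /=; apply: eq_bigr => i _.
    by rewrite CE mulrDl mulrA.
  by rewrite /h e (nextP (p k)) mulrBr opprD addrACA subrr add0r.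
have h0 n k : h k n = 0.
  by elim: n k => [|n IH] k; rewrite hE ?fpsXM0 ?fpsXMS.
have : h 0%N = 0 by apply: fpsP => n; rewrite h0 fps_coef0.
rewrite /h /= => /eqP; rewrite subr_eq0 => /eqP ->.
by apply: (ideal_sum _ iJ) => i _; apply: (idealM _ iJ).
Qed.

Lemma prime_constant (Q : set (fps D)) : prime_ideal Q -> ~ Q fpsX ->
  (exists2 f, Q f & f != 0) -> exists2 f, Q f & f 0 != 0.
Proof.
move=> /prime_idealP[_ _ Qp] QX [f Qf f0].
have [n fn] : exists n, f n != 0.
  apply: contrapT => nf; move/eqP: f0; apply; apply: fpsP => n; rewrite fps_coef0.
  by apply: contrapT => /eqP fn; apply: nf; exists n.
elim: n f Qf fn {f0} => [|n IH] f Qf fn; first by exists f.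
have [f0|] := eqVneq (f 0) 0; last by exists f.
by move: Qf; rewrite (fpsX_dvd f0) => /Qp[//|] /IH; apply.
Qed.

Hypothesis D_dedekind : dedekind D.

Lemma dedekind_fps_prime_eq (P Q : set (fps D)) :
  prime_ideal P -> prime_ideal Q -> P `<=` Q -> (exists2 f, P f & f != 0) ->
  ~ Q fpsX -> P = Q.
Proof.
have [D_noeth _ D_dim1] := D_dedekind.
move=> pP pQ PQ Pn0 QX; apply/seteqP; split=> // f Qf; apply: contrapT => Pf.
have /prime_idealP[iP P1 PM] := pP; have /prime_idealP[iQ Q1 QM] := pQ.
pose I n : set (fps D) := [set g | exists s a, ~ Q s /\ P (s * g - f ^+ n * a)].
have iI n : ideal (I n).
  apply/idealP; split.
    by exists 1, 0; split=> //; rewrite !mulr0 subr0; apply: (ideal0 iP).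
  move=> b u v [s [a [Qs hs]]] [t [c [Qt ht]]].
  exists (s * t), (b * a * t + c * s); split; first by move=> /QM[].
  have -> : s * t * (b * u + v) - f ^+ n * (b * a * t + c * s) =
    b * t * (s * u - f ^+ n * a) + s * (t * v - f ^+ n * c) by ring.
  by apply: (idealD iP); apply: (idealM _ iP).
have PI n : P `<=` I n.
  move=> g Pg; exists 1, 0; split=> //; rewrite mulr0 subr0.
  exact: (idealM _ iP).
have IS n : I n.+1 `<=` I n.
  move=> g [s [a [Qs h]]]; exists s, (f * a); split=> //.
  by rewrite mulrA -exprSr.
have PX : ~ P fpsX by move=> /PQ.
have [g Pg g0] := prime_constant pP PX Pn0.
have [||||n nE] := dim1_dcc D_noeth D_dim1 (constants_ideal iP) _ (J := fun n => constants (I n)).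
- by exists (g 0) => //; exists g.
- by move=> n; apply: constants_ideal.
- by move=> n c [h Ph <-]; exists h => //; apply: PI.
- by move=> n c [h Ih <-]; exists h => //; apply: IS.
have In : I n (f ^+ n) by exists 1, 1; rewrite mul1r mulr1 subrr; split=> //; apply: (ideal0 iP).
have /(_ _ In) : I n `<=` I n.+1.
  apply: constants_sub => // [h [s [a [Qs hP]]]|]; last by rewrite nE.
  by exists (s * fpsX), a; split; [move=> /QM[]|rewrite -mulrA].
(* Nakayama's argument: cancelling [f ^+ n], which is not in [P], leaves [s - f * a] in [P], so [s]
   would be in [Q]. *)
move=> [s [a [Qs]]].
have -> : s * f ^+ n - f ^+ n.+1 * a = f ^+ n * (s - f * a) by rewrite exprS; ring.
move=> /PM[/(prime_idealX pP)//|/PQ Qsf]; apply: Qs; rewrite -[s](subrK (f * a)).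
by apply: (idealD iQ) => //; apply: (idealMl _ iQ).
Qed.

Lemma prime_fpsX (P : set (fps D)) : prime_ideal P -> P fpsX ->
  exists2 q : set D, prime_ideal q & forall f, P f <-> q (f 0).
Proof.
move=> /prime_idealP[iP P1 PM] PX; pose q : set D := [set c | P (fps_const c)].
have PE f : P f <-> q (f 0).
  have -> : f = fps_const (f 0) + fpsX * Fps (fun n => f n.+1).
    apply: fpsP => -[|n]; first by rewrite -[RHS]/(f 0 + (fpsX * _) 0) fpsXM0 addr0.
    by rewrite -[RHS]/(0 + (fpsX * _) n.+1) fpsXMS add0r.
  rewrite -[X in q X]/(f 0 + (fpsX * _) 0) fpsXM0 addr0; split=> [h|h].
    rewrite /q /= -(addrK (fpsX * Fps (fun n => f n.+1)) (fps_const _)).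
    by apply: (idealB iP) => //; apply: (idealMl _ iP).
  by apply: (idealD iP) => //; apply: (idealMl _ iP).
exists q => //; apply/prime_idealP; split=> //.
- apply/idealP; split; first by apply/(PE 0)/(ideal0 iP).
  move=> a u v; rewrite -[u]/((fps_const u) 0) -[v]/((fps_const v) 0) => /PE Pu /PE Pv.
  rewrite -[a]/((fps_const a) 0) -fps_mul0; apply/(PE (_ + _)).
  by apply: (idealD iP) => //; apply: (idealM _ iP).
- move=> u v; rewrite -[u]/((fps_const u) 0) -[v]/((fps_const v) 0) -fps_mul0.
  by move=> /(PE (_ * _)).2 /PM[/PE|/PE]; [left|right].
Qed.

(** When [X] lies in [P2], both [P2] and [P3] come from primes of [D]. If that of [P2] is nonzero it
    is maximal, so [P2 = P3]; if it is zero, [P2] is the ideal of [X], and a nonzero prime inside it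
    is all of it. *)
Lemma dedekind_fps_chain (P1 P2 P3 : set (fps D)) :
  prime_ideal P1 -> prime_ideal P2 -> prime_ideal P3 ->
  (exists2 f, P1 f & f != 0) -> P1 `<=` P2 -> P2 `<=` P3 -> P1 = P2 \/ P2 = P3.
Proof.
have [_ _ D_dim1] := D_dedekind.
move=> p1 p2 p3 n1 s12 s23; have [P2X|P2X] := pselect (P2 fpsX); last first.
  by left; apply: dedekind_fps_prime_eq.
have [q2 pq2 P2E] := prime_fpsX p2 P2X; have [q3 pq3 P3E] := prime_fpsX p3 (s23 _ P2X).
have [q20|q2n0] := pselect (q2 = [set 0]); last first.
  right; have /maximal_idealP[_ _ mq] := D_dim1 _ pq2 q2n0.
  have /prime_idealP[iq3 q31 _] := pq3.
  have e : q3 = q2.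
    apply: mq => // c q2c; rewrite -[c]/((fps_const c) 0); apply/P3E/s23/P2E.
    by [].
  by apply/seteqP; split=> // f; rewrite P3E e => /P2E.
left; have [P1X|P1X] := pselect (P1 fpsX); last first.
  have [f P1f f0] := prime_constant p1 P1X n1.
  by have /P2E := s12 _ P1f; rewrite q20 /= => f00; rewrite f00 eqxx in f0.
have [q1 pq1 P1E] := prime_fpsX p1 P1X; apply/seteqP; split=> // f /P2E.
rewrite q20 /= => f0; apply/P1E; rewrite f0.
by have /prime_idealP[iq1 _ _] := pq1; apply: (ideal0 iq1).
Qed.

End PowerSeries.

(** * Krull dimension and height *)

Lemma card_le_II_or_inj T (S : set T) n :
  S #<= `I_n \/ exists f : 'I_n.+1 -> T, injective f /\ forall i, S (f i).
Proof.
have [/finite_setP[m Sm]|/infiniteP/card_leTP[f [finj fS]]] := pselect (finite_set S); last first.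
  by right; exists (fun i => f (val i)); split=> [i j /finj/val_inj|].
have [mn|nm] := leqP m n.
  by left; rewrite (card_le_eql Sm) card_le_II.
right; apply: card_leTP; rewrite -(card_le_eql card_II) (card_le_eqr Sm).
by rewrite card_le_II.
Qed.

Lemma inj_card_IID1 T n (f : 'I_n.+1 -> T) (p : T) :
  injective f -> range f p -> `I_n #<= range f `\ p.
Proof.
move=> finj [i0 _ <-]; rewrite (card_le_eql card_II).
apply: (@inj_card_leT _ _ _ (fun i => f (lift i0 i))) => [i j /finj/lift_inj //|i].
by split=> [|/finj/eqP]; [exists (lift i0 i)|rewrite eq_sym (negbTE (neq_lift _ _))].
Qed.

Section KrullDimension.
Variable A : comNzRingType.

Lemma xget_chain (C : set (set A)) : prime_chain C -> C (xget set0 C).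
Proof. by move=> [C0 _ _]; apply: xgetPex. Qed.

Lemma krull_dim_eq_II n (f : 'I_n.+1 -> set A) : injective f ->
  (forall i, prime_ideal (f i)) -> (forall i j, f i `<=` f j \/ f j `<=` f i) ->
  (forall C : set (set A), prime_chain C -> chain_length C #<= `I_n) ->
  krull_dim_eq A `I_n.
Proof.
move=> finj fp ft ub; split=> //.
have ch : prime_chain (range f).
  by split=> [|_ [i _ <-]//|_ _ [i _ <-] [j _ <-]]; [exists (f ord0), ord0|].
exists (range f); split=> //; apply: Cantor_Bernstein; first exact: ub.
by apply: inj_card_IID1 => //; apply: xget_chain.
Qed.

Lemma krull_dim_ge_aleph (phi : set aleph1 -> set A) : injective phi ->
  (forall x, prime_ideal (phi x)) ->
  (forall x y, phi x `<=` phi y \/ phi y `<=` phi x) ->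
  krull_dim_ge A [set: set aleph1].
Proof.
move=> inj pr tot; have [s [t0 [sinj st0]]] := aleph1_shift.
exists (range phi); split.
  by split=> [|_ [i _ <-]//|_ _ [i _ <-] [j _ <-]]; [exists (phi set0), set0|].
exact: (@card_le_setD1 _ _ (range phi) _ phi s t0).
Qed.

Lemma krull_dim_ge_aleph_II n : krull_dim_ge A [set: set aleph1] ->
  ~ forall C : set (set A), prime_chain C -> chain_length C #<= `I_n.
Proof.
move=> [C [chC alC]] /(_ C chC)/(card_le_trans alC)/card_le_finite/(_ (finite_II n)) fin.
have [unc _] := aleph1P; apply/unc/finite_set_countable/(card_le_finite _ fin).
apply: (@inj_card_leT _ _ _ (fun x => [set x])) => // x y /seteqP[xy _].
exact: (xy x).
Qed.

End KrullDimension.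

Lemma prime_zero (R : idomainType) : prime_ideal [set 0 : R].
Proof.
apply/prime_idealP; split.
- by apply/idealP; split=> // a u v /= -> ->; rewrite mulr0 addr0.
- by move=> /= /eqP; rewrite oner_eq0.
- by move=> u v /= /eqP; rewrite mulf_eq0 => /orP[/eqP|/eqP]; [left|right].
Qed.

(** * Primes of a localization *)

Section LocalizationPrimes.
Variables (A : idomainType) (P : prime_idealr A).
Local Notation L := (localization P).

Let nz b : b \notin P -> tofrac b != 0.
Proof. by apply: contraNneq => /eqP; rewrite tofrac_eq0 => /eqP ->; rewrite idealr0. Qed.
Let nM b d : b \notin P -> d \notin P -> b * d \notin P.
Proof. by move=> hb hd; rewrite prime_idealrM negb_or hb. Qed.
Let P1 : 1 \notin P. Proof. by rewrite idealr1. Qed.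

Let loc_subproof a b : b \notin P -> tofrac a / tofrac b \in localization_pred P.
Proof. by move=> Pb; apply/asboolP; exists a, b. Qed.

Let loc a b (Pb : b \notin P) : L := Subring (loc_subproof a Pb).
Let inj a : L := loc a P1.

Let locP (x : L) : exists a b (Pb : b \notin P), x = loc a Pb.
Proof.
case: x => u hu; have /asboolP[a [b [Pb e]]] := hu; exists a, b, Pb.
exact: subring_val_inj.
Qed.

Let eq_frac a b c d : b \notin P -> d \notin P ->
  tofrac a / tofrac b = tofrac c / tofrac d -> a * d = c * b.
Proof.
move=> Pb Pd /eqP; rewrite eqr_div ?nz // -!tofracM tofrac_eq => /eqP //.
Qed.

Let loc_lin a b c d e f (Pb : b \notin P) (Pd : d \notin P) (Pf : f \notin P) :
  loc a Pb * loc c Pd + loc e Pf =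
  loc (a * c * f + e * (b * d)) (nM (nM Pb Pd) Pf).
Proof.
apply: subring_val_inj; rewrite subring_valD subring_valM /=.
by rewrite mulf_div addf_div ?mulf_neq0 ?nz // !(tofracM, tofracD).
Qed.

Let loc_mul a b c d (Pb : b \notin P) (Pd : d \notin P) :
  loc a Pb * loc c Pd = loc (a * c) (nM Pb Pd).
Proof. by apply: subring_val_inj; rewrite subring_valM /= mulf_div !tofracM. Qed.

Let inj_lin a u v : inj (a * u + v) = inj a * inj u + inj v.
Proof.
by apply: subring_val_inj; rewrite subring_valD subring_valM /= tofrac1 !divr1 tofracD tofracM.
Qed.

Let inj_mul a u : inj (a * u) = inj a * inj u.
Proof. by apply: subring_val_inj; rewrite subring_valM /= tofrac1 !divr1 tofracM. Qed.

Let inj1 : inj 1 = 1.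
Proof. by apply: subring_val_inj; rewrite subring_val1 /= divr1 tofrac1. Qed.

Let inj0 : inj 0 = 0.
Proof. by apply: subring_val_inj; rewrite subring_val0 /= tofrac0 mul0r. Qed.

Definition extension (Q : set A) : set L :=
  [set x | exists a b, [/\ Q a, b \notin P & val x = tofrac a / tofrac b]].

Definition contraction (Q : set L) : set A := [set a | Q (inj a)].

Section Extension.
Variable Q : set A.
Hypotheses (Q_prime : prime_ideal Q) (QP : Q `<=` [set` P]).

Let extE a b (Pb : b \notin P) : extension Q (loc a Pb) <-> Q a.
Proof.
have /prime_idealP[iQ _ QM] := Q_prime; split=> [[c [d [Qc Pd /= /(eq_frac Pb Pd) e]]]|Qa].
  have : Q (a * d) by rewrite e; apply: idealMl.
  by move=> /QM[//|/QP]; rewrite /= (negbTE Pd).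
by exists a, b.
Qed.

Lemma extension_prime : prime_ideal (extension Q).
Proof.
have /prime_idealP[iQ Q1 QM] := Q_prime; apply/prime_idealP; split.
- apply/idealP; split; first by rewrite -inj0; apply/extE; apply: (ideal0 iQ).
  move=> x u v; have [a [b [Pb ->]]] := locP x; have [c [d [Pd ->]]] := locP u.
  have [e [f [Pf ->]]] := locP v; rewrite loc_lin => /extE Qc /extE Qe; apply/extE.
  by apply: idealD => //; apply: idealMl => //; apply: idealM.
- by rewrite -inj1 => /extE.
- move=> u v; have [a [b [Pb ->]]] := locP u; have [c [d [Pd ->]]] := locP v.
  by rewrite loc_mul => /extE/QM[Qa|Qc]; [left|right]; apply/extE.
Qed.

Lemma extensionK : contraction (extension Q) = Q.
Proof. by apply/seteqP; split=> a; [move=> /extE|move=> Qa; apply/extE]. Qed.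

End Extension.

Lemma extension_sub (Q Q' : set A) : Q `<=` Q' -> extension Q `<=` extension Q'.
Proof. by move=> QQ' x [a [b [Qa Pb e]]]; exists a, b; split=> //; apply: QQ'. Qed.

Lemma contraction_prime (Q : set L) : prime_ideal Q -> prime_ideal (contraction Q).
Proof.
move=> /prime_idealP[iQ Q1 QM]; apply/prime_idealP; split.
- apply/idealP; split; first by rewrite /contraction /mkset inj0; apply: ideal0.
  move=> a u v; rewrite /contraction /mkset inj_lin => Qu Qv.
  by apply: idealD => //; apply: idealM.
- by rewrite /contraction /mkset inj1.
- by move=> u v; rewrite /contraction /mkset inj_mul; apply: QM.
Qed.

Lemma contraction_sub (Q : set L) : prime_ideal Q -> contraction Q `<=` [set` P].
Proof.
move=> /prime_idealP[iQ Q1 QM] a Qa; apply: contrapT => /negP Pa; apply: Q1.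
have -> : 1 = loc 1 Pa * inj a; last exact: idealM.
apply: subring_val_inj; rewrite subring_valM subring_val1 /= tofrac1 divr1 div1r.
by rewrite mulVf ?nz.
Qed.

Lemma contractionK (Q : set L) : prime_ideal Q -> extension (contraction Q) = Q.
Proof.
move=> /prime_idealP[iQ _ _]; apply/seteqP; split=> x.
  move=> [a [b [Qa Pb e]]]; have -> : x = loc 1 Pb * inj a; last exact: idealM.
  apply: subring_val_inj; rewrite subring_valM /= tofrac1 divr1 div1r.
  by rewrite mulrC; apply: e.
have [a [b [Pb ->]]] := locP x => Qx; exists a, b; split=> //.
rewrite /contraction /mkset; have -> : inj a = inj b * loc a Pb; last exact: idealM.
apply: subring_val_inj; rewrite subring_valM /= tofrac1 !divr1.
by rewrite mulrCA divff ?nz // mulr1.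
Qed.

Lemma height_ge_aleph (phi : set aleph1 -> set A) : injective phi ->
  (forall x, prime_ideal (phi x)) ->
  (forall x y, phi x `<=` phi y \/ phi y `<=` phi x) ->
  (forall x, phi x `<=` [set` P]) ->
  height_ge P [set: set aleph1].
Proof.
move=> inj_ pr tot sub; apply: (@krull_dim_ge_aleph _ (fun x => extension (phi x))).
- move=> x y e; apply: inj_; rewrite -(extensionK (pr x) (sub x)) e.
  exact: extensionK.
- by move=> x; apply: extension_prime.
- by move=> x y; have [h|h] := tot x y; [left|right]; apply: extension_sub.
Qed.

Lemma height_eq1 : (exists2 x, x \in P & x != 0) ->
  (forall Q : set A, prime_ideal Q -> Q <> [set 0] -> Q `<=` [set` P] -> [set` P] `<=` Q) ->
  height_eq P `I_1.
Proof.
move=> [x0 Px0 x0n0] minimal.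
have pP := prime_idealr_prime P.
have ext0 : extension [set` P] <> [set 0].
  move=> e; have : contraction (extension [set` P]) x0 by rewrite extensionK.
  rewrite e /contraction /= => /(congr1 (@subring_val _ _)).
  rewrite subring_val0 /= tofrac1 divr1 => /eqP; rewrite tofrac_eq0.
  by apply/negP.
have unique (Q : set L) : prime_ideal Q -> Q <> [set 0] -> Q = extension [set` P].
  move=> pQ Q0; rewrite -[LHS]contractionK //; congr extension.
  apply/seteqP; split; first exact: contraction_sub.
  apply: minimal; [exact: contraction_prime| |exact: contraction_sub].
  move=> c0; apply: Q0; rewrite -(contractionK pQ) c0; apply/seteqP; split=> [x|x /= ->].
    move=> [a [b [/= -> Pb e]]]; apply: subring_val_inj; rewrite subring_val0.
    by apply: etrans e _; rewrite tofrac0 mul0r.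
  exists 0, 1; split=> //; rewrite tofrac0 mul0r; exact: subring_val0.
pose f (i : 'I_2) : set L := if val i is 0%N then [set 0] else extension [set` P].
have f_prime i : prime_ideal (f i).
  by rewrite /f; case: (val i) => [|_]; [apply: prime_zero|apply: extension_prime].
have zero_sub (Q : set L) : prime_ideal Q -> [set 0] `<=` Q.
  by move=> /prime_idealP[iQ _ _] x /= ->; apply: ideal0.
apply: (@krull_dim_eq_II _ 1 f) => //.
- case=> [[|[|//]] hi] [[|[|//]] hj]; rewrite /f /= => e; apply: val_inj => //=.
  by case: ext0; rewrite -e.
- move=> i j; have := f_prime i; have := f_prime j; rewrite /f.
  case: (val i) => [|_] pj pi; first by left; apply: zero_sub.
  by case: (val j) pj => [|_] pj; [right; apply: zero_sub|left].
(* Two members besides the removed [xget set0 C] would make three distinct primes, where only two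
   exist. *)
- move=> C chC; have [//|[g [ginj gC]]] := @card_le_II_or_inj _ (chain_length C) 1.
  have Cp := xget_chain chC; have [_ Cpr _] := chC; exfalso.
  have [[C0 p0] [C1 p1]] := (gC ord0, gC ord_max).
  have g01 : g ord0 <> g ord_max by move=> /ginj.
  have [U0 U1 Up] := And3 (unique _ (Cpr _ C0)) (unique _ (Cpr _ C1)) (unique _ (Cpr _ Cp)).
  have [e0|e0] := pselect (g ord0 = [set 0]).
    have e1 : g ord_max <> [set 0] by rewrite -e0; apply: nesym.
    by apply: p1 => /=; rewrite (U1 e1) Up // => e; apply: p0; rewrite /= e0 e.
  have [e1|e1] := pselect (g ord_max = [set 0]); last by apply: g01; rewrite (U0 e0) (U1 e1).
  by apply: p0 => /=; rewrite (U0 e0) Up // => e; apply: p1; rewrite /= e1 e.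
Qed.

End LocalizationPrimes.

(** * Height of M[[X]] for M finitely generated and locally principal *)

Section PowerSeriesHeight.
Variables (D : idomainType) (M : prime_idealr D).

Lemma fps_constM c (f : fps D) n : (fps_const c * f) n = c * f n.
Proof.
rewrite /= big_ord_recl subn0 big1 ?addr0 // => i _.
by rewrite mul0r.
Qed.

(** Local divisibility by [d] has a denominator depending on [x]. Finitely many generators share the
    product of theirs, and this uniform [s] allows dividing a power series coefficientwise. *)
Lemma locally_principal_denominator (t : seq D) d :
  [set` M] = ideal_span [set` t] -> (forall x, x \in M -> ldvd [set` M] d x) ->
  exists2 s, s \notin M & forall x, x \in M -> exists y, s * x = y * d.
Proof.
move=> Mt Md; have [s Ms st] : exists2 s, s \notin M &
    forall x, x \in t -> exists y, s * x = y * d.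
  have : [set` t] `<=` [set` M] by rewrite Mt; apply: sub_ideal_span.
  elim: (t) => [_|x r IH rM]; first by exists 1; rewrite ?idealr1.
  have [|s Ms sr] := IH; first by move=> y yr; apply: rM; rewrite /= inE [y \in r]yr orbT.
  have [|s' [y [/negP Ms' e]]] := Md x; first by apply: rM; rewrite /= mem_head.
  exists (s * s'); first by rewrite prime_idealrM negb_or Ms.
  move=> z; rewrite inE => /orP[/eqP ->|/sr[w hw]].
    by exists (s * y); rewrite -mulrA e mulrA.
  by exists (s' * w); rewrite -mulrA mulrCA hw mulrA.
exists s => // x Mx; pose I : set D := [set z | exists y, s * z = y * d].
suff /(_ x Mx) : [set` M] `<=` I by [].
rewrite Mt; apply: ideal_span_min => [|z zt]; last exact: st.
apply/idealP; split; first by exists 0; rewrite mulr0 mul0r.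
move=> a u v [y hy] [w hw]; exists (a * y + w).
by rewrite mulrDr mulrCA hy hw mulrDl mulrA.
Qed.

(** Let [Q] be a nonzero prime inside M[[X]]. Were [d] not in [Q], a nonzero [f] of [Q] could be
    divided by [d] forever within [Q], up to powers of [s], so a nonzero coefficient of [f] would be
    divisible at [M] by all powers of [d], against [arch]. So [d] is in [Q], and as [s] is not, [Q]
    is everything. *)
Lemma fps_ideal_height1 : (exists s : seq D, [set` M] = ideal_span [set` s]) ->
  locally_principal [set` M] ->
  (forall x d : D, x != 0 -> d \in M -> exists k, ldvd [set` M] x (d ^+ k)) ->
  height_eq (fps_ideal M) `I_1.
Proof.
move=> [t Mt] [d [Md d0 dM]] arch.
have [s Ms sM] := locally_principal_denominator Mt dM.
have memP (f : fps D) : f \in fps_ideal M <-> forall i, f i \in M.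
  by split=> [/asboolP //|fM]; apply/asboolP.
have const_nz (c : D) : c != 0 -> fps_const c != 0.
  move=> c0; apply/eqP => e; have /eqP := congr1 (fun f : fps D => f 0%N) e.
  by rewrite /= (negbTE c0).
have sdiv (f : fps D) : f \in fps_ideal M -> exists g, fps_const s * f = fps_const d * g.
  move=> /memP fM; have [g gE] := choice (fun i => sM (f i) (fM i)).
  by exists (Fps g); apply: fpsP => i; rewrite !fps_constM gE mulrC.
apply: height_eq1.
  exists (fps_const d); last exact: const_nz.
  by apply/memP => i /=; case: ifP => // _; apply: idealr0.
move=> Q pQ Q0 QP; have /prime_idealP[iQ _ QM] := pQ.
have [f Qf f0] := prime_neq0 pQ Q0.
have Qs : ~ Q (fps_const s).
  by move=> /QP/memP/(_ 0%N) /=; apply/negP.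
suff Qd : Q (fps_const d).
  move=> g /sdiv[h e]; have : Q (fps_const s * g) by rewrite e; apply: idealMl.
  by case/QM.
apply: contrapT => Qd.
have pow k : exists2 g, Q g & forall i, s ^+ k * f i = d ^+ k * g i.
  elim: k => [|k [g Qg gE]]; first by exists f => // i; rewrite !expr0.
  have [h hE] := sdiv g (QP _ Qg); exists h => [|i].
    by have : Q (fps_const d * h) by [rewrite -hE; apply: idealM]; case/QM.
  rewrite exprS -mulrA gE mulrCA -fps_constM hE fps_constM exprSr.
  by rewrite mulrA.
have [j fj] : exists j, f j != 0.
  apply: contrapT => nf; move/eqP: f0; apply; apply: fpsP => n; rewrite fps_coef0.
  by apply: contrapT => /eqP fn; apply: nf; exists n.
have [k [r [y [/negP Mr e]]]] := arch (f j) d fj Md.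
have [g Qg gE] := pow k; have gM : g j \in M by apply/(memP g).1/QP.
have : r * s ^+ k = y * g j.
  apply: (mulIf fj); rewrite -mulrA gE mulrA e; ring.
move=> /(congr1 (fun z => z \in M)); rewrite (idealMr _ gM) prime_idealrM (negbTE Mr) /=.
by elim: (k) => [|l IH]; rewrite ?expr0 ?idealr1 // exprS prime_idealrM (negbTE Ms).
Qed.

End PowerSeriesHeight.

(** * Dimension over a Dedekind domain *)

Section DedekindDimension.
Variable D : idomainType.
Hypothesis D_dedekind : dedekind D.

(** Three members besides the removed one make four distinct primes, at most one of them zero; three
    nonzero primes in a chain contradict [dedekind_fps_chain]. *)
Lemma dedekind_chain_length (C : set (set (fps D))) :
  prime_chain C -> chain_length C #<= `I_2.
Proof.
move=> chC; have [//|[g [ginj gC]]] := @card_le_II_or_inj _ (chain_length C) 2.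
have Cp := xget_chain chC; have [_ Cpr Ct] := chC; exfalso.
have sorted P Q R : C P -> C Q -> C R -> P <> [set 0] -> P `<=` Q -> Q `<=` R ->
    P <> Q -> Q <> R -> False.
  move=> CP CQ CR P0 PQ QR nPQ nQR.
  by have [] := dedekind_fps_chain D_dedekind (Cpr _ CP) (Cpr _ CQ) (Cpr _ CR)
    (prime_neq0 (Cpr _ CP) P0) PQ QR.
have distinct P Q R : C P -> C Q -> C R -> P <> [set 0] -> Q <> [set 0] ->
    R <> [set 0] -> P <> Q -> Q <> R -> P <> R -> False.
  move=> CP CQ CR P0 Q0 R0 nPQ nQR nPR.
  have [nQP nRQ nRP] := And3 (nesym nPQ) (nesym nQR) (nesym nPR).
  have [PQ|QP] := Ct _ _ CP CQ; have [QR|RQ] := Ct _ _ CQ CR; have [PR|RP] := Ct _ _ CP CR.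
  - exact: (sorted P Q R).
  - exact: (sorted P Q R).
  - exact: (sorted P R Q).
  - exact: (sorted R P Q).
  - exact: (sorted Q P R).
  - exact: (sorted Q R P).
  - exact: (sorted R Q P).
  - exact: (sorted R Q P).
pose p := xget set0 C.
pose o0 : 'I_3 := ord0; pose o1 : 'I_3 := inord 1; pose o2 : 'I_3 := inord 2.
have [n01 n12 n02] : [/\ g o0 <> g o1, g o1 <> g o2 & g o0 <> g o2].
  by split=> /ginj/(congr1 val); rewrite /= ?inordK.
have [[C0 p0] [C1 p1] [C2 p2]] := And3 (gC o0) (gC o1) (gC o2).
have [e0|g0] := pselect (g o0 = [set 0]).
  apply: (@distinct (g o1) (g o2) p) => //.
  - by rewrite -e0; apply: nesym.
  - by rewrite -e0; apply: nesym.
  - by rewrite -e0; apply: nesym.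
have [e1|g1] := pselect (g o1 = [set 0]).
  apply: (@distinct (g o0) (g o2) p) => //.
  - by rewrite -e1; apply: nesym.
  - by rewrite -e1; apply: nesym.
have [e2|g2] := pselect (g o2 = [set 0]).
  apply: (@distinct (g o0) (g o1) p) => //.
  by rewrite -e2; apply: nesym.
exact: (@distinct (g o0) (g o1) (g o2)).
Qed.

Lemma dedekind_fps_dim : (exists x : D, x != 0 /\ forall y, y * x != 1) ->
  krull_dim_eq (fps D) `I_2.
Proof.
move=> [x [x0 xu]]; pose I : set D := [set z | exists r, z = r * x].
have [||M mM IM] := @exists_maximal _ I.
- apply/idealP; split; first by exists 0; rewrite mul0r.
  by move=> a _ _ [r ->] [s ->]; exists (a * r + s); rewrite mulrDl mulrA.
- by move=> [r /esym/eqP]; apply/negP.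
have Mx : M x by apply: IM; exists 1; rewrite mul1r.
have lift_prime (q : set D) : prime_ideal q -> prime_ideal [set f : fps D | q (f 0)].
  move=> /prime_idealP[iq q1 qM]; apply/prime_idealP; split=> //.
  - apply/idealP; split; first exact: (ideal0 iq).
    move=> a u v /= qu qv; rewrite -[X in q X]/((a * u) 0 + v 0) fps_mul0.
    by apply: idealD => //; apply: idealM.
  - move=> u v; rewrite /mkset fps_mul0; exact: qM.
pose f (i : 'I_3) : set (fps D) := match val i with
  | 0 => [set 0] | 1 => [set g | [set 0] (g 0)] | _ => [set g | M (g 0)] end.
have f_prime i : prime_ideal (f i).
  rewrite /f; case: (val i) => [|[|_]]; first exact: prime_zero.
    exact/lift_prime/prime_zero.
  exact/lift_prime/maximal_prime.
have /maximal_idealP[iM M1 _] := mM.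
have sub0 (i : 'I_3) : [set 0] `<=` f i.
  by have /prime_idealP[ifi _ _] := f_prime i; move=> z /= ->; apply: ideal0.
have f01 : [set 0 : fps D] <> [set g | [set 0] (g 0)].
  move=> /seteqP[_ /(_ (fpsX D))] /= h; have := congr1 (fun g : fps D => g 1%N) (h erefl).
  by rewrite /= => /eqP; rewrite oner_eq0.
have f12 : [set g : fps D | [set 0] (g 0)] <> [set g | M (g 0)].
  by move=> /seteqP[_ /(_ (fps_const x) Mx)] /= /eqP; apply/negP.
have f02 : [set 0 : fps D] <> [set g | M (g 0)].
  move=> /seteqP[_ /(_ (fps_const x) Mx)] /= /(congr1 (fun g : fps D => g 0)) /= /eqP.
  exact/negP.
have sub12 : [set g : fps D | [set 0] (g 0)] `<=` [set g | M (g 0)].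
  by move=> g /= ->; apply: ideal0.
apply: (@krull_dim_eq_II _ 2 f) => //; last exact: dedekind_chain_length.
- case=> [[|[|[|//]]] hi] [[|[|[|//]]] hj]; rewrite /f /= => e; apply: val_inj => //=.
  + by case: f01; apply: esym.
  + by case: f02; apply: esym.
  + by case: f12; apply: esym.
- case=> [[|[|[|//]]] hi] [[|[|[|//]]] hj]; rewrite /f /=; try by left.
  + by left; apply: (sub0 (Ordinal hj)).
  + by left; apply: (sub0 (Ordinal hj)).
  + by right; apply: (sub0 (Ordinal hi)).
  + by right; apply: (sub0 (Ordinal hi)).
  + by right.
Qed.

End DedekindDimension.

Lemma card_fps_le (D : idomainType) : countable [set: D] ->
  [set: fps D] #<= [set: set nat].
Proof.
move=> /countable_injP[f f_inj].
have finj : injective f by move=> x y; apply: f_inj; rewrite inE.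
apply: (@inj_card_leT _ _ _ (fun (h : fps D) => [set pickle (n, f (h n)) | n in setT])) => // g h.
move=> /seteqP[gh _]; apply: fpsP => n.
have [|m _ e] := gh (pickle (n, f (g n))); first by exists n.
by have [<- /finj ->] := pcan_inj pickleK e.
Qed.

Lemma card_set_le (T U : Type) : [set: T] #<= [set: U] -> [set: set T] #<= [set: set U].
Proof.
move=> /card_leTP[f [finj _]]; apply: (@inj_card_leT _ _ _ (fun A => f @` A)) => //.
move=> A B /seteqP[AB BA]; apply/seteqP; split=> x.
  by move=> Ax; have [|y By /finj <-] := AB (f x); first by exists x.
by move=> Bx; have [|y Ay /finj <-] := BA (f x); first by exists x.
Qed.

Theorem corollary2p10 (D : idomainType) (Dn : nat -> subringClosed D)
    (Dn_system : dedekind_system Dn)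
    (D_union : forall x : D, exists n, x \in Dn n) :
  [/\ dedekind D <-> krull_dim_eq (fps D) `I_2,
      (~ dedekind D <-> krull_dim_ge (fps D) [set: set aleph1]) /\
      (~ dedekind D -> continuum_hypothesis -> countable [set: D] ->
         krull_dim_eq (fps D) [set: set aleph1])
    & forall M : prime_idealr D, maximal_ideal [set` M] ->
        almost_dedekind D ->
        height_eq (fps_ideal M) `I_1 \/
        height_ge (fps_ideal M) [set: set aleph1]].
Proof.
have dim_ge : ~ dedekind D -> krull_dim_ge (fps D) [set: set aleph1].
  move=> /(system_not_dedekind Dn_system D_union)[M _ [phi [inj pr tot _]]].
  exact: krull_dim_ge_aleph inj pr tot.
split; first split.
- by move=> dD; apply: dedekind_fps_dim => //; apply: system_nonunit Dn_system D_union.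
- move=> [_ ub]; apply: contrapT => /dim_ge/krull_dim_ge_aleph_II; apply; exact: ub.
- split; first split=> [//|/krull_dim_ge_aleph_II h dD].
    by apply: h; apply: dedekind_chain_length.
  move=> /dim_ge[C [chC alC]] CH countD.
  (* Under the continuum hypothesis D[[X]] has at most aleph_1 elements for countable [D], so at
     most 2^aleph_1 subsets. *)
  have ub (C' : set (set (fps D))) : chain_length C' #<= [set: set aleph1].
    apply: (card_le_trans (card_leT _)); apply: card_set_le.
    by rewrite -(card_le_eqr CH); apply: card_fps_le.
  split=> [|C' _]; last exact: ub.
  by exists C; split=> //; apply: Cantor_Bernstein.
- move=> M mM _; have M0 := maximal_neq0 Dn_system D_union mM.
  have [[phi [inj pr tot phiM]]|[fg lp]] := maximal_dichotomy Dn_system D_union mM.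
    right; apply: (height_ge_aleph inj pr tot) => x f fx; apply/asboolP => i.
    exact: phiM fx.
  left; apply: fps_ideal_height1 => // x d x0 Md.
  exact: (system_ldvd_archimedean Dn_system D_union (maximal_prime mM) M0).
Qed.
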